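(* Assume that (1) $\mathbb{E}[|\mathbf{X}|^2]\le pK$ and $\|f\|_\infty\le C$ for some constants $K,C\ge 1$; and (2) there are constants $\sigma,\Gamma>0$ such that $\mathbb{E}[|\varepsilon|^k\mid \mathbf{X}]\le \frac{k!}{2}\sigma^2\Gamma^{k-2}$ almost surely for all integers $k\ge 2$. Then there are constants $\Xi_0,\Xi_1>0$ depending only on $C,\Gamma,\sigma$ such that, for $\lambda=n/\Xi_0$ and all sufficiently large $n$, for every $\delta\in(0,1)$ it holds with probability at least $1-\delta$ that \[ \mathcal{E}(\hat f_\lambda)\le \min_{\mathcal{I}}\Big(4\,\mathcal{E}(f_{\theta^*_{\mathcal{I}}})+\frac{\Xi_1}{n}\big(|\mathcal{I}|\,L\log(p\vee n)+\log(2/\delta)\big)\Big), \] where the minimum is over all nonempty $\mathcal{I}\subseteq\{1,\dots,P\}$.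
   Context: Data: $\mathcal{D}_n=(\mathbf{X}_i,Y_i)_{i=1,\dots,n}$ are i.i.d. copies of $(\mathbf{X},Y)\in\mathbb{R}^p\times\mathbb{R}$ with $Y=f(\mathbf{X})+\varepsilon$ and $\mathbb{E}[\varepsilon\mid\mathbf{X}]=0$ a.s. For a function $g$, $R(g)=\mathbb{E}[(Y-g(\mathbf{X}))^2]$, $R_n(g)=\frac1n\sum_{i=1}^n(Y_i-g(\mathbf{X}_i))^2$, and the excess risk is $\mathcal{E}(g)=R(g)-R(f)=\|g-f\|^2_{L^2(\mathbb{P}^{\mathbf{X}})}$. Networks: with $\sigma(x)=\max(x,0)$ applied coordinatewise and $L,r\in\mathbb{N}$, let $g_\theta(\mathbf{x})=W^{(L+1)}\mathbf{x}^{(L)}+v^{(L+1)}$ where $\mathbf{x}^{(0)}=\mathbf{x}\in\mathbb{R}^p$, $\mathbf{x}^{(l)}=\sigma(W^{(l)}\mathbf{x}^{(l-1)}+v^{(l)})$ for $l=1,\dots,L$, with $W^{(1)}\in\mathbb{R}^{r\times p}$, $W^{(2)},\dots,W^{(L)}\in\mathbb{R}^{r\times r}$, $W^{(L+1)}\in\mathbb{R}^{1\times r}$, $v^{(1)},\dots,v^{(L)}\in\mathbb{R}^r$, $v^{(L+1)}\in\mathbb{R}$, all entries collected in $\theta\in\mathbb{R}^P$, $P=(p+1)r+(L-1)(r+1)r+r+1$. The clipped network is $f_\theta=(-C)\vee(g_\theta\wedge C)$; write $R(\theta)=R(f_\theta)$, $R_n(\theta)=R_n(f_\theta)$. Prior: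 fix $B\ge1$. For $\mathcal{I}\subseteq\{1,\dots,P\}$ let $\mathcal{S}_{\mathcal{I}}=\{\theta\in[-B,B]^P:\theta_i=0\text{ for }i\notin\mathcal{I}\}$ and $\Pi_{\mathcal{I}}$ the uniform distribution on $\mathcal{S}_{\mathcal{I}}$ (uniform in the coordinates in $\mathcal{I}$, others zero). The prior is $\Pi=\sum_{i=1}^P 2^{-i}\sum_{|\mathcal{I}|=i}\binom{P}{i}^{-1}\Pi_{\mathcal{I}}/C_P$ with $C_P=1-2^{-P}$. Gibbs posterior: $\Pi_\lambda(d\theta\mid\mathcal{D}_n)\propto\exp(-\lambda R_n(\theta))\Pi(d\theta)$ for $\lambda>0$; the estimator is $\hat f_\lambda=f_{\hat\theta_\lambda}$ with $\hat\theta_\lambda\mid\mathcal{D}_n\sim\Pi_\lambda(\cdot\mid\mathcal{D}_n)$. The probability is with respect to both the data and the posterior draw. Oracle: $\theta^*_{\mathcal{I}}\in\arg\min_{\theta\in\mathcal{S}_{\mathcal{I}}}R(\theta)$. *)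

(* Defs.v *)
From HB Require Import structures.
From mathcomp Require Import all_boot all_order all_algebra.
From mathcomp Require Import all_classical all_reals all_analysis.
Set Implicit Arguments. Unset Strict Implicit. Unset Printing Implicit Defensive.
Import Order.TTheory GRing.Theory Num.Theory.
Import numFieldNormedType.Exports.
Local Open Scope classical_set_scope.
Local Open Scope ring_scope.

Section Defs.
Variable R : realType.

(* Index type of the parameter vector theta:
   ((W^(1) entries + v^(1) entries)
    + (hidden layers l = 2..L, indexed by m = l-2 : 'I_(L-1),
       each with W^(l) entries + v^(l) entries))
   + (W^(L+1) entries + v^(L+1)).
   Its cardinality is P = (p+1)r + (L-1)(r+1)r + r + 1. *)
Definition Idx (p L r : nat) : finType :=
  ((('I_r * 'I_p) + 'I_r)
   + ('I_(L.-1) * (('I_r * 'I_r) + 'I_r))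
   + ('I_r + unit))%type.

Definition relu (x : R) : R := Num.max x 0.

Definition layer1 p L r (th : Idx p L r -> R) (x : 'I_p -> R) : 'I_r -> R :=
  fun j => relu (\sum_(k < p) th (inl (inl (inl (j, k)))) * x k
                 + th (inl (inl (inr j)))).

Definition hidden p L r (th : Idx p L r -> R) (m : 'I_(L.-1)) (h : 'I_r -> R)
  : 'I_r -> R :=
  fun j => relu (\sum_(k < r) th (inl (inr (m, inl (j, k)))) * h k
                 + th (inl (inr (m, inr j)))).

Definition outlayer p L r (th : Idx p L r -> R) (h : 'I_r -> R) : R :=
  \sum_(k < r) th (inr (inl k)) * h k + th (inr (inr tt)).

Definition gnet p L r (th : Idx p L r -> R) (x : 'I_p -> R) : R :=
  outlayer th (foldl (fun h m => hidden th m h) (layer1 th x) (enum 'I_(L.-1))).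

Definition fnet p L r (C : R) (th : Idx p L r -> R) (x : 'I_p -> R) : R :=
  Num.max (- C) (Num.min (gnet th x) C).

Definition cylinders (p : nat) : set (set ('I_p -> R)) :=
  [set A | exists j : 'I_p, exists B : set R,
      measurable B /\ A = [set x | B (x j)]].

Definition borelRp (p : nat) : set (set ('I_p -> R)) := <<s @cylinders p >>.

Definition borel_fun (p : nat) (g : ('I_p -> R) -> R) : Prop :=
  forall B : set R, measurable B -> @borelRp p (g @^-1` B).

Definition sigmaX d (Omega : measurableType d) (p : nat) (X : Omega -> 'I_p -> R)
  : set (set Omega) :=
  [set X @^-1` A | A in @borelRp p].

Definition risk d (Omega : measurableType d) (Pr : probability Omega R) (p : nat)
  (X : Omega -> 'I_p -> R) (Y : Omega -> R) (g : ('I_p -> R) -> R) : \bar R :=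
  (\int[Pr]_w ((Y w - g (X w)) ^+ 2)%:E)%E.

Definition excess d (Omega : measurableType d) (Pr : probability Omega R) (p : nat)
  (X : Omega -> 'I_p -> R) (f g : ('I_p -> R) -> R) : \bar R :=
  (\int[Pr]_w ((g (X w) - f (X w)) ^+ 2)%:E)%E.

Definition emp_risk p L r (C : R) (D : seq (('I_p -> R) * R)) (th : Idx p L r -> R) : R :=
  (size D)%:R^-1 * \sum_(z <- D) (z.2 - fnet C th z.1) ^+ 2.

Definition S_I p L r (B : R) (I : {set Idx p L r}) : set (Idx p L r -> R) :=
  [set th | forall i, (i \in I -> - B <= th i <= B) /\ (i \notin I -> th i = 0)].

Definition upd p L r (th : Idx p L r -> R) (i : Idx p L r) (t : R) : Idx p L r -> R :=
  fun j => if j == i then t else th j.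

(* integral of h against the uniform distribution on [-B,B] of each of the
   coordinates listed in s (iterated one-dimensional integrals), starting from th *)
Fixpoint unif_iter p L r (B : R) (s : seq (Idx p L r))
    (h : (Idx p L r -> R) -> \bar R) (th : Idx p L r -> R) : \bar R :=
  match s with
  | [::] => h th
  | i :: s' => (((2 * B)^-1)%:E *
       \int[lebesgue_measure]_(t in `[(- B)%R, B]) unif_iter B s' h (upd th i t))%E
  end.

(* integral of h against Pi_I, the uniform distribution on S_I *)
Definition int_PiI p L r (B : R) (I : {set Idx p L r}) (h : (Idx p L r -> R) -> \bar R)
  : \bar R := unif_iter B (enum I) h (fun _ => 0).

Definition int_prior p L r (B : R) (h : (Idx p L r -> R) -> \bar R) : \bar R :=
  let P := #|Idx p L r| in
  (\sum_(1 <= i < P.+1)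
     ((2%:R ^- i) / 'C(P, i)%:R / (1 - 2%:R ^- P))%:E *
     \sum_(I : {set Idx p L r} | #|I| == i) int_PiI B I h)%E.

Definition gibbs_post p L r (C B lam : R) (D : seq (('I_p -> R) * R))
  (A : set (Idx p L r -> R)) : R :=
  fine (int_prior B (fun th => (\1_A th * expR (- lam * emp_risk C D th))%:E)) /
  fine (int_prior B (fun th : Idx p L r -> R => (expR (- lam * emp_risk C D th))%:E)).

(* integral of F(w_1,...,w_n) against the n-fold product Pr^{(x)n}
   (iterated integrals) *)
Fixpoint iter_int d (Omega : measurableType d) (Pr : probability Omega R) (n : nat)
  (F : seq Omega -> \bar R) : \bar R :=
  match n with
  | 0 => F [::]
  | n'.+1 => (\int[Pr]_w iter_int Pr n' (fun s => F (w :: s)))%E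
  end.

(* probability, w.r.t. the sample D_n and the draw hat theta ~ Pi_lambda(. | D_n),
   that hat theta lies in A *)
Definition prob_event d (Omega : measurableType d) (Pr : probability Omega R)
  p L r (C B lam : R) (X : Omega -> 'I_p -> R) (Y : Omega -> R) (n : nat)
  (A : set (Idx p L r -> R)) : \bar R :=
  iter_int Pr n (fun ws => (gibbs_post C B lam [seq (X w, Y w) | w <- ws] A)%:E).

End Defs.

(* Main.v *)
(** Let [z_th = (Y - f_th(X))^2 - eps^2] be the excess loss and [E th] its mean.
    By the moment condition, [v |-> E[exp(v eps) | X]] is bounded by
    [1 + sig^2 v^2] for small [v], so for [t = 1 / Xi0] small enough
    [E[exp(- t z_th)] <= exp(- 4/5 t E th)] and [E[exp(t z_th)] <= exp(3/2 t E th)].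

    Write the Gibbs weights as [W = exp(- t * \sum z_th)], and let [A] be the
    (deterministic) event [E th <= T].  The posterior mass of the complement of
    [A] is [N / Z] with [N = \int_{~A} W dPi] and [Z = \int W dPi].  As
    [N / Z <= 1], it is at most [sqrt (N / Z) <= (s N + 1 / (s Z)) / 2] for every
    [s > 0], and [1 / Z <= Pi(U)^-2 \int_U W^-1 dPi] for every set [U] of positive
    prior mass.  Both terms are now linear in [W] and [W^-1], so their expectations
    are products over the sample.  Take for [U] the parameters supported on [I]
    within [1/n] of the oracle: the network is Lipschitz in its parameters, hence
    [E th <= 2 E th* + O(1/n^2)] on [U], while [Pi(U) >= (4 B P n)^-|I|].  Choosing
    [s = delta exp(4/5 n t T)] gives the bound. *)

Require Import Defs.
From HB Require Import structures.
From mathcomp Require Import all_boot all_order all_algebra.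
From mathcomp Require Import all_classical all_reals all_analysis.
From mathcomp Require Import measurable_realfun ring lra.
Import Order.TTheory GRing.Theory Num.Theory.
Import numFieldNormedType.Exports.
Local Open Scope classical_set_scope.
Local Open Scope ring_scope.
Set Implicit Arguments. Unset Strict Implicit. Unset Printing Implicit Defensive.

(** * Nonnegative real-valued integrands *)

(** The posterior mass of a set is a ratio of two prior integrals over the same sample, so its
    expectation does not factor. Separating numerator and denominator lets independence act. It also
    confines the stochastic analysis to one parameter at a time, because [A] and [U] are fixed
    before the data. The price is [delta ^+ 2] in place of [delta], which only changes the factor of
    [ln delta]. The leading factor 4 of the oracle inequality is a matter of rates: on [U] the
    excess risk at most doubles and grows at rate 3/2, giving 3, while outside [A] it decays at rate
    4/5, giving 16/5 against a threshold of four times the oracle risk. The surplus 1/5 keeps the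
    exponent negative. Two encodings shape the technical part. Conditional moments are given as
    integrals over events of sigma(X), so they must be upgraded to integrals against weights
    depending on X. The prior is given by iterated integrals, so exchanging it with the sample
    expectation needs its own measurability calculus. *)

Section real_integrals.
Context d (T : measurableType d) (R : realType) (mu : {measure set T -> \bar R}).
Implicit Types f g : T -> R.

Lemma intR_ge0 f (D : set T) : (forall w, 0 <= f w) -> (0 <= \int[mu]_(w in D) (f w)%:E)%E.
Proof. by move=> f0; apply: integral_ge0 => w _; rewrite lee_fin. Qed.

Lemma intR_le f g : measurable_fun setT f -> measurable_fun setT g ->
  (forall w, 0 <= f w) -> (forall w, f w <= g w) ->
  (\int[mu]_w (f w)%:E <= \int[mu]_w (g w)%:E)%E.
Proof.
move=> mf mg f0 fg; apply: ge0_le_integral => //.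
- by move=> w _; rewrite lee_fin.
- exact/measurable_EFinP.
- exact/measurable_EFinP.
- by move=> w _; rewrite lee_fin.
Qed.

Lemma intRD f g : measurable_fun setT f -> measurable_fun setT g ->
  (forall w, 0 <= f w) -> (forall w, 0 <= g w) ->
  (\int[mu]_w (f w + g w)%:E = \int[mu]_w (f w)%:E + \int[mu]_w (g w)%:E)%E.
Proof.
move=> mf mg f0 g0; under eq_integral do rewrite EFinD.
rewrite ge0_integralD//; try exact/measurable_EFinP;
  by move=> w _; rewrite lee_fin.
Qed.

Lemma intRZ (k : R) f : measurable_fun setT f -> 0 <= k -> (forall w, 0 <= f w) ->
  (\int[mu]_w (k * f w)%:E = k%:E * \int[mu]_w (f w)%:E)%E.
Proof.
move=> mf k0 f0; under eq_integral do rewrite EFinM.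
rewrite ge0_integralZl_EFin//; last exact/measurable_EFinP.
by move=> w _; rewrite lee_fin.
Qed.

End real_integrals.

Section real_prob_integrals.
Context d (T : measurableType d) (R : realType) (P : probability T R).

Lemma intR_cst (k : R) : (\int[P]_w k%:E = k%:E)%E.
Proof.
rewrite -[RHS]mule1 -(@probability_setT _ _ _ P).
exact: (integral_cst P measurableT k%:E).
Qed.

Lemma intR_bounded (f : T -> R) (k : R) : measurable_fun setT f ->
  (forall w, 0 <= f w <= k) -> (0 <= \int[P]_w (f w)%:E <= k%:E)%E.
Proof.
move=> mf fk; apply/andP; split.
  by apply: intR_ge0 => w; have /andP[] := fk w.
rewrite -intR_cst; apply: intR_le => // w; by have /andP[] := fk w.
Qed.

End real_prob_integrals.

(** Layer cake: [phi] is the integral over s >= 0 of the indicator of s < [phi], so Tonelli reduces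
    the weighted comparison to the superlevel sets. When [phi] is a function of X these sets lie in
    sigma(X), which is where the conditional moment hypotheses speak. *)
Lemma integral_mul_le_of_superlevel d (T : measurableType d) (R : realType)
    (P : probability T R) (phi a b : T -> R) :
  measurable_fun setT phi -> measurable_fun setT a -> measurable_fun setT b ->
  (forall w, 0 <= phi w) -> (forall w, 0 <= a w) -> (forall w, 0 <= b w) ->
  (forall s, (\int[P]_(w in [set w | (s < phi w)%R]) (a w)%:E <=
              \int[P]_(w in [set w | (s < phi w)%R]) (b w)%:E)%E) ->
  (\int[P]_w (phi w * a w)%:E <= \int[P]_w (phi w * b w)%:E)%E.
Proof.
move=> mphi ma mb phi0 a0 b0 ab.
(* Integrating [g c] over the level gives [phi * c] ([inner]); integrating over the sample point
   gives the superlevel integral ([outer]). *)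
pose g (c : T -> R) (z : T * R) : \bar R :=
  (if (0 <= z.2) && (z.2 < phi z.1) then c z.1 else 0)%:E.
have mg (c : T -> R) : measurable_fun setT c -> measurable_fun setT (g c).
  move=> mc; apply/measurable_EFinP; apply: measurable_fun_ifT => //.
    apply: measurable_and; first exact: measurable_fun_ler.
    by apply: measurable_fun_ltr => //; exact: measurableT_comp.
  exact: measurableT_comp.
have g0 (c : T -> R) : (forall w, 0 <= c w) -> forall z, (0 <= g c z)%E.
  by move=> c0 z; rewrite /g; case: ifPn => //; rewrite lee_fin.
have inner (c : T -> R) w : (forall w, 0 <= c w) ->
    (\int[lebesgue_measure]_s g c (w, s) = (phi w * c w)%:E)%E.
  move=> c0.
  transitivity (\int[lebesgue_measure]_s
     ((c w)%:E * (\1_(`[0%R, phi w[%classic : set R) s)%:E))%E.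
    apply: eq_integral => s _; rewrite /g indicE mem_setE in_itv /=.
    by case: ifPn => _; rewrite ?mule1 ?mule0.
  rewrite ge0_integralZl_EFin//; last exact/measurable_EFinP.
  rewrite integral_indic// setIT [X in (_ * X)%E]lebesgue_measure_itv /= lte_fin.
  have := phi0 w; rewrite le_eqVlt => /orP[/eqP <-|->].
    by rewrite ltxx mule0 mul0r.
  by rewrite -EFinB subr0 -EFinM mulrC.
have outer c s : (\int[P]_w g c (w, s) =
    if (0 <= s)%R then \int[P]_(w in [set w | (s < phi w)%R]) (c w)%:E else 0)%E.
  case: ifPn => s0; last first.
    by rewrite integral0_eq// => w _; rewrite /g /= (negbTE s0).
  rewrite [RHS]integral_mkcond; apply: eq_integral => w _.
  rewrite /g /= s0 /= patchE.
  have -> : (w \in [set w | (s < phi w)%R]) = (s < phi w)%R.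
    by apply/idP/idP; rewrite inE.
  by case: ifPn.
have swap (c : T -> R) : measurable_fun setT c -> (forall w, 0 <= c w) ->
   (\int[P]_w (phi w * c w)%:E = \int[lebesgue_measure]_s \int[P]_w g c (w, s))%E.
  move=> mc c0; under eq_integral do rewrite -inner//.
  by apply: (fubini_tonelli (m1 := P) (m2 := lebesgue_measure) (g c)); [exact: mg|exact: g0].
rewrite !swap//; apply: ge0_le_integral => //.
- by move=> s _; apply: integral_ge0 => w _; exact: g0.
- by apply: (measurable_fun_fubini_tonelli_G (m1 := P) (g a)); [exact: mg|exact: g0].
- by apply: (measurable_fun_fubini_tonelli_G (m1 := P) (g b)); [exact: mg|exact: g0].
- by move=> s _; rewrite !outer; case: ifPn.
Qed.

(** * Moment generating functions under the Bernstein condition *)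

Lemma expR_eseries (R : realType) (x : R) : 0 <= x ->
  ((expR x)%:E = \sum_(0 <= k <oo) (x ^+ k / k`!%:R)%:E)%E.
Proof.
move=> x0; rewrite /expR -EFin_lim; last exact: is_cvg_series_exp_coeff.
by apply/congr_lim/funext => n/=; rewrite /series/= -sumEFin.
Qed.

Lemma expR_ge_quadratic (R : realType) (x : R) : 0 <= x ->
  1 + x + x ^+ 2 / 2 <= expR x.
Proof.
move=> x0; rewrite -lee_fin expR_eseries//.
apply: le_trans (nneseries_lim_ge 3 _); last first.
  by move=> k _ _; rewrite lee_fin divr_ge0// exprn_ge0.
by rewrite !big_nat_recr//= big_nil add0e -!EFinD lee_fin !factS fact0; lra.
Qed.

(** The product (1 - x + x^2/2)(1 + x + x^2/2) equals 1 + x^4/4 >= 1, so the lower bound on [expR x]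
    inverts into this upper bound. *)
Lemma expRN_le_quadratic (R : realType) (x : R) : 0 <= x ->
  expR (- x) <= 1 - x + x ^+ 2 / 2.
Proof.
move=> x0; have h := expR_ge_quadratic x0.
rewrite expRN; have p : 0 < 1 + x + x ^+ 2 / 2 by nra.
apply: (@le_trans _ _ (1 + x + x ^+ 2 / 2)^-1).
  by rewrite lef_pV2// posrE expR_gt0.
rewrite -[leLHS]mul1r ler_pdivrMr//.
have -> : (1 - x + x ^+ 2 / 2) * (1 + x + x ^+ 2 / 2) = 1 + (x ^+ 2) ^+ 2 / 4 by field.
by rewrite lerDl divr_ge0// sqr_ge0.
Qed.

(** The linear term keeps its sign, so that a centred variable makes it vanish, while the higher
    terms appear as absolute moments, the quantities that the Bernstein condition bounds. For x < 0
    the left side is at most 1 + x + x^2/2, and the series is at least its first term x^2/2. *)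
Lemma expR_le_eseries (R : realType) (x : R) :
  ((expR x)%:E <= (1 + x)%:E + \sum_(0 <= k <oo) (`|x| ^+ k.+2 / (k.+2)`!%:R)%:E)%E.
Proof.
have E : ((expR `|x|)%:E = (1 + `|x|)%:E +
    \sum_(0 <= k <oo) (`|x| ^+ k.+2 / (k.+2)`!%:R)%:E)%E.
  have ge0 k : (0 <= (`|x| ^+ k / k`!%:R)%:E)%E.
    by rewrite lee_fin divr_ge0// exprn_ge0.
  rewrite expR_eseries// (nneseries_split 0 2)//.
  rewrite add0n big_nat_recr//= big_nat1/= expr0 expr1 !fact0 !divr1 EFinD.
  congr +%E; rewrite -nneseries_addn//.
  by apply: eq_eseriesr => k _; rewrite addn2.
have [x0|x0] := leP 0 x.
  by move: E; rewrite (ger0_norm x0) => <-.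
have y0 : 0 <= - x by lra.
have := expRN_le_quadratic y0; have := expR_ge_quadratic y0; move: E.
rewrite ltr0_norm// opprK.
set S := (\big[_/_]_(_ <= _ <oo) _)%E.
case: S => [s| |]; [|by move=> *; rewrite addey// leey|by []].
by rewrite -EFinD => -[->]; rewrite -EFinD lee_fin; lra.
Qed.

(** Origin of the rate 4/5: the quadratic term y^2/2 and the noise term s y each cost at most
    y/10. *)
Lemma expRN_mul_le (R : realType) (y s : R) : 0 <= y <= 1 / 5 -> 0 <= s <= 1 / 10 ->
  expR (- y) * (1 + s * y) <= 1 - 4 / 5 * y.
Proof.
move=> /andP[y0 y1] /andP[s0 s1].
have h1 := expRN_le_quadratic y0.
have h2 : expR (- y) <= 1 by rewrite expR_le1; lra.
have h3 : expR (- y) * (s * y) <= s * y by rewrite ler_piMl// mulr_ge0.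
have h4 : s * y <= 1 / 10 * y by rewrite ler_wpM2r.
have h5 : y ^+ 2 <= 1 / 5 * y by rewrite expr2 ler_wpM2r.
by rewrite mulrDr mulr1; lra.
Qed.

(** Here [expR y] is at most 1/(1 - y), hence at most 1 + 5y/4 on this range. The rate 3/2 is a
    rounding; the final comparison needs a rate below 8/5. *)
Lemma expR_mul_le (R : realType) (y s : R) : 0 <= y <= 1 / 5 -> 0 <= s <= 1 / 10 ->
  expR y * (1 + s * y) <= 1 + 3 / 2 * y.
Proof.
move=> /andP[y0 y1] /andP[s0 s1].
have h1 : expR y <= 1 + 5 / 4 * y.
  have := expR_ge1Dx (- y); rewrite expRN => h.
  have e0 := expR_gt0 y.
  have : (1 - y) * expR y <= 1 by rewrite -ler_pdivlMr// mul1r.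
  have h5 : y ^+ 2 <= 1 / 5 * y by rewrite expr2 ler_wpM2r.
  by nra.
have h4 : s * y <= 1 / 10 * y by rewrite ler_wpM2r.
have sy : 0 <= s * y by rewrite mulr_ge0.
have h5 : y ^+ 2 <= 1 / 5 * y by rewrite expr2 ler_wpM2r.
apply: (@le_trans _ _ ((1 + 5 / 4 * y) * (1 + 1 / 10 * y))).
  by apply: ler_pM => //; rewrite ?expR_ge0//; lra.
by nra.
Qed.

Lemma measurable_superlevel d (T : measurableType d) (R : realType) (g : T -> R) (s : R) :
  measurable_fun setT g -> measurable [set u | s < g u].
Proof.
move=> mg; have := mg measurableT _ (measurable_itv `]s, +oo[); rewrite setTI.
by congr measurable; apply/seteqP; split => u /=; rewrite in_itv/= andbT.
Qed.

(** * Conditional moment generating function of the noise *)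

Section conditional_bernstein.
Context (R : realType) d (T : measurableType d) d' (U : measurableType d').
Variables (P : probability T R) (X : T -> U) (eps : T -> R) (sig Gam : R).
Hypothesis mX : measurable_fun setT X.
Hypothesis meps : measurable_fun setT eps.
Hypothesis ieps : P.-integrable setT (EFin \o eps).
Hypothesis eps0 : forall A, measurable A ->
  (\int[P]_(w in X @^-1` A) (eps w)%:E = 0)%E.
Hypothesis epsk : forall k, (2 <= k)%N -> forall A, measurable A ->
  (\int[P]_(w in X @^-1` A) (`|eps w| ^+ k)%:E
     <= (k`!%:R / 2 * sig ^+ 2 * Gam ^+ (k - 2))%:E * P (X @^-1` A))%E.
Hypothesis Gam0 : 0 < Gam.

(** The layer-cake comparison handles nonnegative integrands only, so the centring of [eps] is
    carried as an equality between the integrals of its positive and negative parts, first on events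
    of sigma(X), then against nonnegative weights in X. *)
Let ep w := Num.max (eps w) 0.
Let en w := Num.max (- eps w) 0.

Let mep : measurable_fun setT ep.
Proof. exact: measurable_maxr. Qed.

Let men : measurable_fun setT en.
Proof. by apply: measurable_maxr => //; exact: measurableT_comp. Qed.

Let ep0 w : 0 <= ep w. Proof. by rewrite /ep le_max lexx orbT. Qed.
Let en0 w : 0 <= en w. Proof. by rewrite /en le_max lexx orbT. Qed.

Let mXA A : measurable A -> measurable (X @^-1` A).
Proof. by move=> mA; rewrite -[X in measurable X]setTI; exact: mX. Qed.

Let ep_le w : ep w <= `|eps w|.
Proof. by rewrite /ep ge_max ler_norm normr_ge0. Qed.

Let en_le w : en w <= `|eps w|.
Proof. by rewrite /en ge_max normr_ge0 andbT -normrN ler_norm. Qed.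

Let int_abs : (\int[P]_w (`|eps w|)%:E < +oo)%E.
Proof. by have /integrableP[_] := ieps. Qed.

Let int_epn A : measurable A ->
  (\int[P]_(w in X @^-1` A) (ep w)%:E = \int[P]_(w in X @^-1` A) (en w)%:E)%E.
Proof.
move=> mA; have mB := mXA mA.
have := eps0 mA; rewrite integralE.
have -> : (\int[P]_(w in X @^-1` A) ((fun w => (eps w)%:E)^\+ w) =
  \int[P]_(w in X @^-1` A) (ep w)%:E)%E.
  by apply: eq_integral => w _; rewrite funeposE -EFin_max.
have -> : (\int[P]_(w in X @^-1` A) ((fun w => (eps w)%:E)^\- w) =
  \int[P]_(w in X @^-1` A) (en w)%:E)%E.
  by apply: eq_integral => w _; rewrite funenegE -EFin_max.
have fin (c : T -> R) : measurable_fun setT c -> (forall w, 0 <= c w) ->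
    (forall w, c w <= `|eps w|) ->
    (\int[P]_(w in X @^-1` A) (c w)%:E)%E \is a fin_num.
  move=> mc c0 cle; rewrite ge0_fin_numE; last by apply: integral_ge0 => w _; rewrite lee_fin.
  apply: le_lt_trans int_abs.
  apply: (@le_trans _ _ (\int[P]_w (c w)%:E)%E).
    apply: ge0_subset_integral => //; first exact/measurable_EFinP.
    by move=> w _; rewrite lee_fin.
  by apply: intR_le => //; exact: measurableT_comp.
have /fineK <- := fin _ mep ep0 ep_le; have /fineK <- := fin _ men en0 en_le.
by rewrite -EFinB => -[] /eqP; rewrite subr_eq0 => /eqP ->.
Qed.

Let int_mul_epn (g : U -> R) : measurable_fun setT g -> (forall u, 0 <= g u) ->
  (\int[P]_w (g (X w) * ep w)%:E = \int[P]_w (g (X w) * en w)%:E)%E.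
Proof.
move=> mg g0; have mgX : measurable_fun setT (fun w => g (X w)) by exact: measurableT_comp.
have mS s : measurable [set u | s < g u].
  exact: measurable_superlevel.
by apply/eqP; rewrite eq_le; apply/andP; split;
   apply: (integral_mul_le_of_superlevel mgX) => // s; rewrite (int_epn (mS s)).
Qed.

(** This is the bound E[exp(v eps) | X] <= 1 + sig^2 v^2 tested against a weight [q]. The linear
    term of the exponential series integrates to zero. By the moment condition the term of order k+2
    contributes at most sig^2 v^2 (V Gam)^k / 2, and V Gam <= 1/2 makes these sum to sig^2 v^2. *)
Lemma conditional_mgf_le (q v : U -> R) (Q V : R) :
  measurable_fun setT q -> measurable_fun setT v ->
  (forall u, 0 <= q u <= Q) -> (forall u, `|v u| <= V) -> V * Gam <= 1 / 2 ->
  (\int[P]_w (q (X w) * expR (v (X w) * eps w))%:E <=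
   \int[P]_w (q (X w) * (1 + sig ^+ 2 * v (X w) ^+ 2))%:E)%E.
Proof.
move=> mq mv q0 vV VG.
have Q0 : 0 <= Q by have /andP[a b] := q0 (X point); exact: le_trans a b.
have V0 : 0 <= V by exact: le_trans (normr_ge0 _) (vV (X point)).
have qge u : 0 <= q u by have /andP[] := q0 u.
have mqX : measurable_fun setT (fun w => q (X w)) by exact: measurableT_comp.
have mvX : measurable_fun setT (fun w => v (X w)) by exact: measurableT_comp.
pose vp u := Num.max (v u) 0.
pose vn u := Num.max (- v u) 0.
have mvp : measurable_fun setT vp by exact: measurable_maxr.
have mvn : measurable_fun setT vn.
  by apply: measurable_maxr => //; exact: measurableT_comp.
have vp0 u : 0 <= vp u by rewrite /vp le_max lexx orbT.
have vn0 u : 0 <= vn u by rewrite /vn le_max lexx orbT.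
have vpV u : vp u <= V by rewrite /vp ge_max V0 (le_trans (ler_norm _) (vV u)).
have vnV u : vn u <= V.
  by rewrite /vn ge_max V0 andbT (le_trans (ler_norm _))// normrN.
pose g1 u := q u * vp u.
pose g2 u := q u * vn u.
have mg1 : measurable_fun setT g1 by exact: measurable_funM.
have mg2 : measurable_fun setT g2 by exact: measurable_funM.
have g10 u : 0 <= g1 u by rewrite mulr_ge0.
have g20 u : 0 <= g2 u by rewrite mulr_ge0.
have mgX (g : U -> R) : measurable_fun setT g -> measurable_fun setT (fun w => g (X w)).
  by move=> mg; exact: measurableT_comp.
pose a w := q (X w) * expR (v (X w) * eps w).
(* Pointwise [c - b] is q v eps, split into nonnegative pieces. Since [b] and [c] have equal
   integrals, the linear term can be moved across the inequality and cancelled without subtracting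
   integrals. *)
pose b w := g1 (X w) * en w + g2 (X w) * ep w.
pose c w := g1 (X w) * ep w + g2 (X w) * en w.
(* Only k of the k+2 factors |v| are bounded by V; the remaining v^2 keeps the final bound
   proportional to v^2. *)
pose k0 k := V ^+ k / (k.+2)`!%:R.
pose s k w := (q (X w) * v (X w) ^+ 2) * (k0 k * `|eps w| ^+ k.+2).
have k00 k : 0 <= k0 k by rewrite divr_ge0// exprn_ge0.
have ma : measurable_fun setT a.
  by apply: measurable_funM => //; apply: measurableT_comp => //; exact: measurable_funM.
have mb : measurable_fun setT b.
  by apply: measurable_funD; apply: measurable_funM => //; exact: mgX.
have mc : measurable_fun setT c.
  by apply: measurable_funD; apply: measurable_funM => //; exact: mgX.
have mabs k : measurable_fun setT (fun w => k0 k * `|eps w| ^+ k.+2).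
  apply: measurable_funM => //; apply: measurable_funX.
  exact: measurableT_comp.
have mqv : measurable_fun setT (fun u => q u * v u ^+ 2).
  by apply: measurable_funM => //; exact: measurable_funX.
have ms k : measurable_fun setT (s k).
  by apply: measurable_funM => //; exact: (mgX _ mqv).
have a0 w : 0 <= a w by rewrite mulr_ge0// expR_ge0.
have b0 w : 0 <= b w by rewrite addr_ge0// mulr_ge0.
have c0 w : 0 <= c w by rewrite addr_ge0// mulr_ge0.
have qv0 u : 0 <= q u * v u ^+ 2 by rewrite mulr_ge0// sqr_ge0.
have abs0 k w : 0 <= k0 k * `|eps w| ^+ k.+2 by rewrite mulr_ge0// exprn_ge0.
have s0 k w : 0 <= s k w by rewrite mulr_ge0.
have bc : (\int[P]_w (b w)%:E = \int[P]_w (c w)%:E)%E.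
  rewrite !intRD//; try (by move=> w; rewrite mulr_ge0);
    try by apply: measurable_funM => //; exact: mgX.
  by rewrite !int_mul_epn.
have pw w : ((a w + b w)%:E <= (q (X w) + c w)%:E + \sum_(0 <= k <oo) (s k w)%:E)%E.
  have h : ((a w)%:E <= (q (X w) * (1 + v (X w) * eps w))%:E
      + \sum_(0 <= k <oo) (s k w)%:E)%E.
    apply: (@le_trans _ _ ((q (X w))%:E * ((1 + v (X w) * eps w)%:E +
      \sum_(0 <= k <oo) (`|v (X w) * eps w| ^+ k.+2 / (k.+2)`!%:R)%:E))%E).
      by rewrite /a EFinM; apply: lee_wpmul2l; [rewrite lee_fin|exact: expR_le_eseries].
    have S0 : (0 <= \sum_(0 <= k <oo) (`|v (X w) * eps w| ^+ k.+2 / (k.+2)`!%:R)%:E)%E.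
      by apply: nneseries_ge0 => k _ _; rewrite lee_fin divr_ge0// exprn_ge0.
    rewrite muleDr//.
    rewrite EFinM leeD2l// -nneseriesZl; last first.
      by move=> k _; rewrite lee_fin divr_ge0// exprn_ge0.
    apply: lee_nneseries => k _.
      by move=> _; rewrite mule_ge0// lee_fin// divr_ge0// exprn_ge0.
    rewrite -EFinM lee_fin /s /k0 normrM exprMn -mulrA ler_wpM2l//.
    have -> : `|v (X w)| ^+ k.+2 = v (X w) ^+ 2 * `|v (X w)| ^+ k.
      by rewrite -(real_normK (num_real (v _))) -exprD.
    have hv : `|v (X w)| ^+ k <= V ^+ k by rewrite lerXn2r// nnegrE.
    set e := `|eps w| ^+ k.+2; set n := (k.+2)`!%:R.
    have en0' : 0 <= e / n by rewrite divr_ge0// exprn_ge0.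
    have := ler_wpM2r en0' (ler_wpM2l (sqr_ge0 (v (X w))) hv).
    move=> h; apply: (@le_trans _ _ (v (X w) ^+ 2 * `|v (X w)| ^+ k * (e / n))).
      by rewrite le_eqVlt; apply/orP; left; apply/eqP; ring.
    by apply: le_trans h _; rewrite le_eqVlt; apply/orP; left; apply/eqP; ring.
  apply: (@le_trans _ _ ((b w)%:E + ((q (X w) * (1 + v (X w) * eps w))%:E
      + \sum_(0 <= k <oo) (s k w)%:E))%E).
    by rewrite addrC EFinD leeD2l.
  rewrite addeA -EFinD leeD2r// lee_fin le_eqVlt; apply/orP; left; apply/eqP.
  have -> : v (X w) = vp (X w) - vn (X w).
    by rewrite /vp /vn; have [|] := leP (v (X w)) 0; have [|] := leP (- v (X w)) 0; lra.
  have -> : eps w = ep w - en w.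
    by rewrite /ep /en; have [|] := leP (eps w) 0; have [|] := leP (- eps w) 0; lra.
  by rewrite /b /c /g1 /g2; ring.
have iq : (\int[P]_w (q (X w) * v (X w) ^+ 2)%:E < +oo)%E.
  have /andP[_ h] : (0 <= \int[P]_w (q (X w) * v (X w) ^+ 2)%:E <= (Q * V ^+ 2)%:E)%E.
    apply: intR_bounded; first exact: (mgX _ mqv).
    move=> w; rewrite qv0/= ler_pM ?sqr_ge0//; first by have /andP[] := q0 (X w).
    by rewrite -(real_normK (num_real (v _))) lerXn2r// nnegrE.
  exact: le_lt_trans h (ltry _).
set M := (\int[P]_w (q (X w) * v (X w) ^+ 2)%:E)%E in iq.
have M0 : (0 <= M)%E by apply: integral_ge0 => w _; rewrite lee_fin.
have Mfin : M \is a fin_num by rewrite ge0_fin_numE.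
have isk k : (\int[P]_w (s k w)%:E <= (fine M * sig ^+ 2 / (2 ^ (k + 1))%:R)%:E)%E.
  apply: (@le_trans _ _ (\int[P]_w ((q (X w) * v (X w) ^+ 2) * (sig ^+ 2 / (2 ^ (k + 1))%:R))%:E)%E).
    (* The weight q v^2 is a function of X, so the moment hypothesis on its superlevel sets
       suffices. *)
    apply: (integral_mul_le_of_superlevel (mgX _ mqv)) => // [w|t].
      by rewrite divr_ge0// sqr_ge0.
    set A := [set u | t < q u * v u ^+ 2].
    have mA : measurable A by exact: measurable_superlevel.
    have mB := mXA mA.
    under eq_integral do rewrite EFinM.
    rewrite ge0_integralZl_EFin//; last by apply/measurable_EFinP; apply: measurable_funTS; apply: measurable_funX; exact: measurableT_comp.
    rewrite (_ : [set w | t < _] = X @^-1` A)//.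
    apply: (@le_trans _ _ ((k0 k)%:E * ((k.+2`!%:R / 2 * sig ^+ 2 * Gam ^+ (k.+2 - 2))%:E * P (X @^-1` A)))%E).
      by apply: lee_wpmul2l; [rewrite lee_fin|exact: epsk].
    rewrite integral_cst// muleA -EFinM; apply: lee_wpmul2r => //.
    rewrite lee_fin /k0 subSS subSS subn0.
    have -> : V ^+ k / k.+2`!%:R * (k.+2`!%:R / 2 * sig ^+ 2 * Gam ^+ k) =
        sig ^+ 2 / 2 * (V * Gam) ^+ k.
      by rewrite exprMn; field; rewrite pnatr_eq0 -lt0n fact_gt0.
    have -> : ((2 ^ (k + 1))%:R)^-1 = 2^-1 * 2^-1 ^+ k :> R.
      by rewrite addn1 natrX exprS invfM exprVn.
    have VG0 : 0 <= V * Gam by rewrite mulr_ge0// ltW.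
    have h : (V * Gam) ^+ k <= 2^-1 ^+ k by apply: lerXn2r; rewrite ?nnegrE//; lra.
    by rewrite mulrA; apply: ler_wpM2l h; rewrite divr_ge0// sqr_ge0.
  under eq_integral do rewrite mulrC.
  rewrite intRZ//; [|exact: (mgX _ mqv)|by rewrite divr_ge0// sqr_ge0].
  by rewrite -/M -mulrA EFinM fineK// muleC.
have sumM : (\sum_(0 <= k <oo) \int[P]_w (s k w)%:E <= (fine M * sig ^+ 2)%:E)%E.
  apply: (@le_trans _ _ (\sum_(0 <= k <oo) (fine M * sig ^+ 2 / (2 ^ (k + 1))%:R)%:E)%E).
    by apply: lee_nneseries => k _ //; move=> _; apply: integral_ge0 => w _; rewrite lee_fin.
  rewrite le_eqVlt; apply/orP; left; apply/eqP.
  have := @cvg_geometric_eseries_half R (fine M * sig ^+ 2) 0.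
  by rewrite expr0 divr1; exact: cvg_lim.
(* Finiteness is what permits cancelling the integral of [c] on both sides of [main]; it comes from
   the integrability of [eps]. *)
have icf : (\int[P]_w (c w)%:E < +oo)%E.
  apply: (@le_lt_trans _ _ (\int[P]_w ((2 * Q * V)%:E * `|eps w|%:E))%E).
    under [leRHS]eq_integral do rewrite -EFinM.
    apply: intR_le => //.
      by apply: measurable_funM => //; exact: measurableT_comp.
    move=> w; rewrite /c /g1 /g2.
    have /andP[_ qQ] := q0 (X w).
    have h1 : q (X w) * vp (X w) * ep w <= Q * V * `|eps w| by rewrite !ler_pM// mulr_ge0.
    have h2 : q (X w) * vn (X w) * en w <= Q * V * `|eps w| by rewrite !ler_pM// mulr_ge0.
    lra.
  rewrite ge0_integralZl_EFin//; last 2 first.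
  - by apply/measurable_EFinP; exact: measurableT_comp.
  - by rewrite !mulr_ge0.
  by rewrite lte_mul_pinfty// lee_fin !mulr_ge0.
have cfin : (\int[P]_w (c w)%:E)%E \is a fin_num.
  by rewrite ge0_fin_numE//; exact: intR_ge0.
have mS : measurable_fun setT (fun w => \sum_(0 <= k <oo) (s k w)%:E)%E.
  by apply: ge0_emeasurable_sum => [k w _ _|k _]; [rewrite lee_fin|exact/measurable_EFinP].
have main : (\int[P]_w (a w)%:E + \int[P]_w (c w)%:E <=
   (\int[P]_w (q (X w))%:E + \int[P]_w (c w)%:E) + (fine M * sig ^+ 2)%:E)%E.
  rewrite -{1}bc -!intRD//.
  apply: (@le_trans _ _ (\int[P]_w ((q (X w) + c w)%:E + \sum_(0 <= k <oo) (s k w)%:E))%E).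
    apply: ge0_le_integral => //.
    - by move=> w _; rewrite lee_fin addr_ge0.
    - by apply/measurable_EFinP; exact: measurable_funD.
    - apply: emeasurable_funD; first by apply/measurable_EFinP; exact: measurable_funD.
      exact: mS.
  rewrite ge0_integralD//; last 3 first.
  - by move=> w _; rewrite lee_fin addr_ge0.
  - by apply/measurable_EFinP; exact: measurable_funD.
  - by move=> w _; apply: nneseries_ge0 => k _ _; rewrite lee_fin.
  rewrite leeD2l// integral_nneseries//.
    by move=> k; apply/measurable_EFinP.
  by move=> k w _; rewrite lee_fin.
have h : (\int[P]_w (a w)%:E <= \int[P]_w (q (X w))%:E + (fine M * sig ^+ 2)%:E)%E.
  by move: main; rewrite addeAC leeD2rE.
apply: (le_trans h).
under [leRHS]eq_integral do rewrite mulrDr mulr1.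
rewrite intRD//.
- rewrite leeD2l// EFinM fineK// le_eqVlt; apply/orP; left; apply/eqP.
  rewrite muleC -intRZ ?sqr_ge0//; last exact: (mgX _ mqv).
  by apply: eq_integral => w _; congr EFin; ring.
- apply: measurable_funM => //; apply: measurable_funM => //.
  exact: measurable_funX.
- by move=> w; rewrite mulr_ge0// mulr_ge0 ?sqr_ge0.
Qed.
End conditional_bernstein.

(** * Exponential moments of the excess loss of a fixed predictor *)

Section excess_loss_mgf.
Context (R : realType) d (T : measurableType d) d' (U : measurableType d').
Variables (P : probability T R) (X : T -> U) (eps : T -> R) (sig Gam : R).
Hypothesis mX : measurable_fun setT X.
Hypothesis meps : measurable_fun setT eps.
Hypothesis ieps : P.-integrable setT (EFin \o eps).
Hypothesis eps0 : forall A, measurable A ->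
  (\int[P]_(w in X @^-1` A) (eps w)%:E = 0)%E.
Hypothesis epsk : forall k, (2 <= k)%N -> forall A, measurable A ->
  (\int[P]_(w in X @^-1` A) (`|eps w| ^+ k)%:E
     <= (k`!%:R / 2 * sig ^+ 2 * Gam ^+ (k - 2))%:E * P (X @^-1` A))%E.
Hypothesis Gam0 : 0 < Gam.
Variables (f g : U -> R) (C t : R).
Hypotheses (mf : measurable_fun setT f) (mg : measurable_fun setT g).
Hypotheses (fC : forall u, `|f u| <= C) (gC : forall u, `|g u| <= C).
(** Since (g - f)^2 <= 4 C^2, [tC] gives y = t (g - f)^2 <= 1/5, and [tsig] gives s = 4 t sig^2 <=
    1/10. The coefficient of the noise is at most 4 t C in absolute value, so [tGam] is the
    condition V Gam <= 1/2. *)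
Hypotheses (t0 : 0 < t) (tC : 20 * C ^+ 2 * t <= 1) (tsig : 40 * sig ^+ 2 * t <= 1).
Hypothesis tGam : 8 * C * Gam * t <= 1.

Let sqd u := (g u - f u) ^+ 2.
Let E := fine (\int[P]_w (sqd (X w))%:E)%E.

Lemma sqr_dist_bound u : (g u - f u) ^+ 2 <= 4 * C ^+ 2.
Proof.
have := fC u; have := gC u; rewrite !ler_norml => /andP[a b] /andP[c e].
by nra.
Qed.

Lemma excess_bound : (0 <= \int[P]_w ((g (X w) - f (X w)) ^+ 2)%:E <= (4 * C ^+ 2)%:E)%E.
Proof.
apply: intR_bounded.
  apply: measurable_funX; apply: measurable_funB; exact: measurableT_comp.
by move=> w; rewrite sqr_ge0 sqr_dist_bound.
Qed.

Let msqd : measurable_fun setT (fun w => sqd (X w)).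
Proof. by apply: measurable_funX; apply: measurable_funB; exact: measurableT_comp. Qed.

Let EE : (\int[P]_w (sqd (X w))%:E = E%:E)%E.
Proof.
rewrite /E fineK//; have /andP[a b] := excess_bound.
by rewrite ge0_fin_numE//; apply: le_lt_trans b (ltry _).
Qed.

Let y u := t * sqd u.

Let y01 u : 0 <= y u <= 1 / 5.
Proof.
rewrite /y mulr_ge0 ?sqr_ge0 ?(ltW t0)//=.
have := ler_wpM2l (ltW t0) (sqr_dist_bound u); rewrite -/(sqd u).
by move: tC; lra.
Qed.

Let s01 : 0 <= 4 * t * sig ^+ 2 <= 1 / 10.
Proof.
by apply/andP; split; [rewrite mulr_ge0 ?sqr_ge0// mulr_ge0// ltW|move: tsig; lra].
Qed.

Let V_ge (c : R) u : `|c| = 1 -> `|2 * c * t * (f u - g u)| <= 4 * t * C.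
Proof.
move=> c1; rewrite !normrM c1 mulr1 (gtr0_norm t0) ger0_norm//.
have := le_trans (ler_normB (f u) (g u)) (lerD (fC u) (gC u)).
by move=> /(ler_wpM2l (ltW t0)); lra.
Qed.

Let mqv (c : R) : measurable_fun setT (fun u => expR (c * y u)).
Proof.
apply: measurableT_comp => //; apply: measurable_funM => //.
by apply: measurable_funM => //; apply: measurable_funX; exact: measurable_funB.
Qed.

(** The excess loss is (f - g)^2 + 2 (f - g) eps. Its exponential is therefore a weight
    [expR (c * y)] in X times [expR (v * eps)] with v = 2 c t (f - g), and sig^2 v^2 = 4 t sig^2 y.
    Both signs c = 1 and c = -1 are covered at once. *)
Let mgf (c : R) : `|c| = 1 ->
  (\int[P]_w (expR (c * t * ((f (X w) + eps w - g (X w)) ^+ 2 - eps w ^+ 2)))%:E <=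
   \int[P]_w (expR (c * y (X w)) * (1 + 4 * t * sig ^+ 2 * y (X w)))%:E)%E.
Proof.
move=> c1; have c2 : c ^+ 2 = 1 by rewrite -(real_normK (num_real c)) c1 expr1n.
pose v u := 2 * c * t * (f u - g u).
have mv : measurable_fun setT v.
  by apply: measurable_funM => //; exact: measurable_funB.
rewrite (_ : (fun w => _) = (fun w => (expR (c * y (X w)) * expR (v (X w) * eps w))%:E)); last first.
  by apply/funext => w; rewrite -expRD /y /sqd /v; congr (expR _)%:E; ring.
have V1 : 4 * t * C * Gam <= 1 / 2 by move: tGam; lra.
have qQ u : 0 <= expR (c * y u) <= expR (1 / 5).
  rewrite expR_ge0 ler_expR/=; have /andP[a b] := y01 u.
  by rewrite (le_trans (ler_norm _))// normrM c1 (ger0_norm a) !mul1r; move: b; rewrite mul1r.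
have vV u : `|v u| <= 4 * t * C by exact: V_ge.
have h := conditional_mgf_le mX meps ieps eps0 epsk Gam0 (mqv c) mv qQ vV V1.
apply: (le_trans h).
rewrite le_eqVlt; apply/orP; left; apply/eqP; apply: eq_integral => w _.
congr (_ * (1 + _))%:E.
have -> : sig ^+ 2 * v (X w) ^+ 2 = 4 * t * sig ^+ 2 * (t * sqd (X w)) * c ^+ 2.
  by rewrite /v /sqd; ring.
by rewrite c2 mulr1.
Qed.

Lemma mgf_neg_excess_loss :
  (\int[P]_w (expR (- t * ((f (X w) + eps w - g (X w)) ^+ 2 - eps w ^+ 2)))%:E <=
   (expR (- (4 / 5 * t * E)))%:E)%E.
Proof.
have := @mgf (-1); rewrite normrN1 => /(_ erefl).
under [X in (X <= _)%E -> _]eq_integral do rewrite mulN1r.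
move=> /le_trans; apply.
have m1 : measurable_fun setT (fun w => 1 - 4 / 5 * y (X w)).
  by apply: measurable_funB => //; do 2 apply: measurable_funM => //.
have m0 : measurable_fun setT (fun w => y (X w)) by exact: measurable_funM.
apply: (@le_trans _ _ (\int[P]_w (1 - 4 / 5 * y (X w))%:E)%E).
  apply: intR_le => //.
  - apply: measurable_funM; first exact: (measurableT_comp (mqv _)).
    by apply: measurable_funD => //; exact: measurable_funM.
  - move=> w; have /andP[a b] := y01 (X w); have /andP[c e] := s01.
    by rewrite mulr_ge0 ?expR_ge0// addr_ge0// mulr_ge0.
  - by move=> w; rewrite mulN1r; exact: expRN_mul_le.
have h : (\int[P]_w (1 - 4 / 5 * y (X w))%:E + (4 / 5 * t * E)%:E = 1)%E.
  rewrite EFinM -EE -intRZ//; last 2 first.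
  - by rewrite mulr_ge0 ?(ltW t0)//; lra.
  - by move=> w; exact: sqr_ge0.
  rewrite -intRD//.
  - rewrite -(intR_cst P 1); apply: eq_integral => w _; congr EFin.
    by rewrite /y; ring.
  - exact: measurable_funM.
  - by move=> w; have /andP[a b] := y01 (X w); lra.
  - by move=> w; rewrite mulr_ge0 ?sqr_ge0// mulr_ge0 ?(ltW t0)//; lra.
move: h; case: (\int[P]_w _)%E => [r| |]//.
rewrite -EFinD => -[h]; rewrite lee_fin.
by apply: le_trans (expR_ge1Dx _); lra.
Qed.

Lemma mgf_excess_loss :
  (\int[P]_w (expR (t * ((f (X w) + eps w - g (X w)) ^+ 2 - eps w ^+ 2)))%:E <=
   (expR (3 / 2 * t * E))%:E)%E.
Proof.
have := @mgf 1; rewrite normr1 => /(_ erefl).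
under [X in (X <= _)%E -> _]eq_integral do rewrite mul1r.
move=> /le_trans; apply.
have m0 : measurable_fun setT (fun w => y (X w)) by exact: measurable_funM.
have m1 : measurable_fun setT (fun w => 1 + 3 / 2 * y (X w)).
  by apply: measurable_funD => //; apply: measurable_funM.
apply: (@le_trans _ _ (\int[P]_w (1 + 3 / 2 * y (X w))%:E)%E).
  apply: intR_le => //.
  - apply: measurable_funM; first exact: (measurableT_comp (mqv _)).
    by apply: measurable_funD => //; exact: measurable_funM.
  - move=> w; have /andP[a b] := y01 (X w); have /andP[c e] := s01.
    by rewrite mulr_ge0 ?expR_ge0// addr_ge0// mulr_ge0.
  - by move=> w; rewrite mul1r; exact: expR_mul_le.
rewrite intRD//; last 2 first.
- exact: measurable_funM.
- by move=> w; have /andP[a b] := y01 (X w); lra.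
rewrite intR_cst (eq_integral (fun w => (3 / 2 * t * sqd (X w))%:E)); last first.
  by move=> w _; rewrite /y mulrA.
rewrite intRZ//; last 2 first.
- by rewrite mulr_ge0 ?(ltW t0)//; lra.
- by move=> w; exact: sqr_ge0.
by rewrite EE -EFinM -EFinD lee_fin expR_ge1Dx.
Qed.

End excess_loss_mgf.

(** * Integration over samples and parameters *)

Section joint_measurability.
Context (R : realType) (p L r : nat) d (Omega : measurableType d).
Local Notation Theta := (Idx p L r -> R).
Implicit Types (F G : seq Omega -> Theta -> \bar R) (th : Theta).

(* Measurability of [F] on [Omega^n * Theta] for the product sigma-algebra,
   tested along all measurable curves so that no measurable structure has to
   be put on [Theta]. *)
Definition jmeas n F := forall d' (S : measurableType d')
    (ps : nat -> S -> Omega) (ph : S -> Theta),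
  (forall k, measurable_fun setT (ps k)) ->
  (forall i, measurable_fun setT (fun s => ph s i)) ->
  measurable_fun setT (fun s => F (mkseq (ps ^~ s) n) (ph s)).

Lemma jmeas_eq n F G : (forall ws th, size ws = n -> F ws th = G ws th) ->
  jmeas n F -> jmeas n G.
Proof.
move=> FG mF d' S ps ph mps mph.
rewrite (_ : (fun s => _) = (fun s => F (mkseq (ps ^~ s) n) (ph s))); first exact: mF.
by apply/funext => s; rewrite FG// size_mkseq.
Qed.

Lemma mkseq_cons (T : Type) (f : nat -> T) n :
  mkseq f n.+1 = f 0%N :: mkseq (fun k => f k.+1) n.
Proof. by rewrite /mkseq /= (iotaDl 1 0) -map_comp. Qed.

Lemma jmeas_behead n F w : jmeas n.+1 F -> jmeas n (fun ws => F (w :: ws)).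
Proof.
move=> mF d' S ps ph mps mph.
pose ps' k := if k is k'.+1 then ps k' else cst w.
have := mF d' S ps' ph; under eq_fun do rewrite mkseq_cons; apply => //.
by case=> [|k] //=; exact: measurable_cst.
Qed.

Lemma jmeas_fix n F ws : size ws = n -> jmeas n F -> jmeas 0 (fun=> F ws).
Proof.
move=> <- mF d' S ps ph mps mph.
have := mF d' S (fun k => cst (nth point ws k)) ph.
by under eq_fun do rewrite mkseq_nth; apply => // k; exact: measurable_cst.
Qed.

(** The quantification over all [S] in [jmeas] pays off here: S * Omega is again an admissible
    source of curves, so the joint measurability that Tonelli requires is an instance of the
    hypothesis. *)
Lemma jmeas_pair n F d' (S : measurableType d') (ps : nat -> S -> Omega) (ph : S -> Theta) :
  jmeas n.+1 F ->
  (forall k, measurable_fun setT (ps k)) ->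
  (forall i, measurable_fun setT (fun s => ph s i)) ->
  measurable_fun setT (fun z : S * Omega => F (z.2 :: mkseq (ps ^~ z.1) n) (ph z.1)).
Proof.
move=> mF mps mph.
pose ps' k (z : S * Omega) := if k is k'.+1 then ps k' z.1 else z.2.
have := mF _ _ ps' (fun z => ph z.1); under eq_fun do rewrite mkseq_cons; apply => //.
- case=> [|k] /=; first exact: measurable_snd.
  exact: (measurableT_comp (mps k)).
- move=> i; exact: (measurableT_comp (mph i)).
Qed.

Lemma jmeas_section n F ws th : jmeas n.+1 F -> size ws = n ->
  measurable_fun setT (fun w => F (w :: ws) th).
Proof.
move=> mF sz; pose ps k (w : Omega) := if k is k'.+1 then nth point ws k' else w.
have E w : mkseq (ps ^~ w) n.+1 = w :: ws by rewrite mkseq_cons -sz /= mkseq_nth.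
have := mF _ _ ps (fun=> th); under eq_fun do rewrite E; apply.
- by case=> [|k] /=; [exact: measurable_id|exact: measurable_cst].
- by move=> i; exact: measurable_cst.
Qed.

Lemma jmeas_int (Pr : probability Omega R) n F :
  (forall ws th, (0 <= F ws th)%E) -> jmeas n.+1 F ->
  jmeas n (fun ws th => \int[Pr]_w F (w :: ws) th)%E.
Proof.
move=> F0 mF d' S ps ph mps mph.
apply: (measurable_fun_fubini_tonelli_F (m2 := Pr)
  (fun z : S * Omega => F (z.2 :: mkseq (ps ^~ z.1) n) (ph z.1))) => //.
exact: (jmeas_pair (ps := ps) (ph := ph) mF mps mph).
Qed.

Lemma measurable_upd d' (S : measurableType d') (ph : S -> Theta) i j :
  (forall i, measurable_fun setT (fun s => ph s i)) ->
  measurable_fun setT (fun z : S * R => upd (ph z.1) i z.2 j).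
Proof.
move=> mph; rewrite /upd; case: (j == i); first exact: measurable_snd.
exact: (measurableT_comp (mph j)).
Qed.

Lemma jmeas_upd_int (U : probability (measurableTypeR R) R) n F i :
  (forall ws th, (0 <= F ws th)%E) -> jmeas n F ->
  jmeas n (fun ws th => \int[U]_t F ws (upd th i t))%E.
Proof.
move=> F0 mF d' S ps ph mps mph.
apply: (measurable_fun_fubini_tonelli_F (m2 := U)
  (fun z : S * R => F (mkseq (ps ^~ z.1) n) (upd (ph z.1) i z.2))) => //.
apply: (mF _ _ (fun k z => ps k z.1) (fun z => upd (ph z.1) i z.2)).
- by move=> k; exact: (measurableT_comp (mps k)).
- by move=> j; exact: measurable_upd.
Qed.

Lemma measurable_upd1 F i th :
  jmeas 0 F -> measurable_fun setT (fun t : R => F [::] (upd th i t)).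
Proof.
move=> mF.
apply: (mF _ _ (fun k => cst point) (upd th i)).
  by move=> k; exact: measurable_cst.
by move=> j; rewrite /upd; case: (j == i).
Qed.

Lemma fubini_upd (Pr : probability Omega R) (U : probability (measurableTypeR R) R) n F i th ws :
  (forall ws th, (0 <= F ws th)%E) -> jmeas n.+1 F -> size ws = n ->
  (\int[Pr]_w \int[U]_t F (w :: ws) (upd th i t) =
   \int[U]_t \int[Pr]_w F (w :: ws) (upd th i t))%E.
Proof.
move=> F0 mF sz.
apply: (fubini_tonelli (m1 := Pr) (m2 := U)
  (fun z : Omega * R => F (z.1 :: ws) (upd th i z.2))) => //.
pose ps k (z : Omega * R) := if k is k'.+1 then nth point ws k' else z.1.
have := mF _ _ ps (fun z => upd th i z.2).
have E z : mkseq (ps ^~ z) n.+1 = z.1 :: ws by rewrite mkseq_cons -sz /= mkseq_nth.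
under eq_fun do rewrite E; apply.
- by case=> [|k] /=; [exact: measurable_fst|exact: measurable_cst].
- move=> j; rewrite /upd; case: (j == i); [exact: measurable_snd|exact: measurable_cst].
Qed.

(* Integration against a finite measure on [Theta], as an abstract functional:
   the prior is only available through iterated integrals. *)
Record integral_functional (Pr : probability Omega R) (J : (Theta -> \bar R) -> \bar R) : Prop := {
  if_ge0 : forall h, (forall th, 0 <= h th)%E -> (0 <= J h)%E;
  if_le : forall h1 h2, (forall th, 0 <= h1 th)%E ->
    jmeas 0 (fun=> h1) -> jmeas 0 (fun=> h2) -> (forall th, h1 th <= h2 th)%E ->
    (J h1 <= J h2)%E;
  if_add : forall h1 h2, (forall th, 0 <= h1 th)%E -> (forall th, 0 <= h2 th)%E ->
    jmeas 0 (fun=> h1) -> jmeas 0 (fun=> h2) ->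
    (J (fun th => h1 th + h2 th) = J h1 + J h2)%E;
  if_scale : forall (k : R) h, 0 <= k -> (forall th, 0 <= h th)%E ->
    jmeas 0 (fun=> h) -> (J (fun th => k%:E * h th) = k%:E * J h)%E;
  if_jmeas : forall n F, (forall ws th, 0 <= F ws th)%E -> jmeas n F ->
    jmeas n (fun ws _ => J (F ws));
  if_swap : forall n F ws, (forall ws th, 0 <= F ws th)%E -> jmeas n.+1 F ->
    size ws = n ->
    (\int[Pr]_w J (F (w :: ws)) = J (fun th => \int[Pr]_w F (w :: ws) th))%E
}.

Variables (Pr : probability Omega R) (B : R).
Hypothesis B0 : 0 < B.

Let NBB : - B < B. Proof. by move: B0; lra. Qed.

(** Reading the normalised Lebesgue integral as an integral against a probability measure gives
    access to [jmeas_upd_int] and [fubini_upd]. *)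
Lemma unif_iter_cons i s h th :
  jmeas 0 (fun=> unif_iter B s h) ->
  (forall th, 0 <= unif_iter B s h th)%E ->
  (unif_iter B (i :: s) h th = \int[uniform_prob NBB]_t unif_iter B s h (upd th i t))%E.
Proof.
move=> mh u0; rewrite integral_uniform//; last exact: (measurable_upd1 i th mh).
by rewrite /= opprK mulr_natl mulr2n.
Qed.

Lemma unif_iter_ge0 s h th : (forall th, 0 <= h th)%E -> (0 <= unif_iter B s h th)%E.
Proof.
move=> h0; elim: s th => [|i s ih] th //=.
apply: mule_ge0; first by rewrite lee_fin invr_ge0 mulr_ge0// ltW.
by apply: integral_ge0.
Qed.

Lemma unif_iter_jmeas s n F : (forall ws th, 0 <= F ws th)%E -> jmeas n F ->
  jmeas n (fun ws th => unif_iter B s (F ws) th).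
Proof.
move=> F0 mF; elim: s => [|i s ih] //.
have U0 ws th : (0 <= unif_iter B s (F ws) th)%E by exact: unif_iter_ge0.
apply: (jmeas_eq _ (jmeas_upd_int (uniform_prob NBB) i U0 ih)).
by move=> ws th sz; rewrite unif_iter_cons//; exact: jmeas_fix ih.
Qed.

Let unif_iter_jmeas0 s h : (forall th, 0 <= h th)%E -> jmeas 0 (fun=> h) ->
  jmeas 0 (fun=> unif_iter B s h).
Proof. by move=> h0 mh; apply: (@unif_iter_jmeas s 0%N (fun=> h)). Qed.

Let unif_iterS i s h th : (forall th, 0 <= h th)%E -> jmeas 0 (fun=> h) ->
  (unif_iter B (i :: s) h th = \int[uniform_prob NBB]_t unif_iter B s h (upd th i t))%E.
Proof.
move=> h0 mh; apply: unif_iter_cons => //; first exact: unif_iter_jmeas0.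
by move=> ?; exact: unif_iter_ge0.
Qed.

Lemma unif_iter_cst s (k : R) th : unif_iter B s (fun=> k%:E) th = k%:E.
Proof.
elim: s th => [//|i s ih] th /=; under eq_integral do rewrite ih.
rewrite (integral_cst _ _ k%:E)//= [X in (_ * (_ * X))%E]lebesgue_measure_itv /= lte_fin NBB.
rewrite -EFinB -!EFinM; congr EFin; field.
by rewrite gt_eqF.
Qed.

Lemma unif_iter_functional s th : integral_functional Pr (fun h => unif_iter B s h th).
Proof.
split.
- by move=> h h0; exact: unif_iter_ge0.
- move=> h1 h2 h10 m1 m2 h12.
  have h20 th' : (0 <= h2 th')%E by exact: le_trans (h10 _) (h12 _).
  elim: s th => [|i s' ih] th'; first exact: h12.
  rewrite !unif_iterS//; apply: ge0_le_integral => //.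
  + by move=> *; exact: unif_iter_ge0.
  + exact: (measurable_upd1 i th' (unif_iter_jmeas0 s' h10 m1)).
  + exact: (measurable_upd1 i th' (unif_iter_jmeas0 s' h20 m2)).
- move=> h1 h2 h10 h20 m1 m2.
  have m12 : jmeas 0 (fun=> fun th => h1 th + h2 th)%E.
    move=> d' S ps ph mps mph; apply: emeasurable_funD; [exact: m1|exact: m2].
  elim: s th => [//|i s' ih] th'.
  rewrite !unif_iterS//; last by move=> ?; rewrite adde_ge0.
  under eq_integral do rewrite ih.
  rewrite ge0_integralD//.
  + by move=> *; exact: unif_iter_ge0.
  + exact: (measurable_upd1 i th' (unif_iter_jmeas0 s' h10 m1)).
  + by move=> *; exact: unif_iter_ge0.
  + exact: (measurable_upd1 i th' (unif_iter_jmeas0 s' h20 m2)).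
- move=> k h k0 h0 m.
  have mk : jmeas 0 (fun=> fun th => k%:E * h th)%E.
    by move=> d' S ps ph mps mph; apply: measurable_funeM; exact: m.
  elim: s th => [//|i s' ih] th'.
  rewrite !unif_iterS//; last by move=> ?; rewrite mule_ge0// lee_fin.
  under eq_integral do rewrite ih.
  rewrite ge0_integralZl_EFin//.
  + by move=> *; exact: unif_iter_ge0.
  + exact: (measurable_upd1 i th' (unif_iter_jmeas0 s' h0 m)).
- move=> n F F0 mF d' S ps ph mps mph.
  apply: (unif_iter_jmeas s F0 mF mps (ph := fun=> th)) => i.
  exact: measurable_cst.
- move=> n F ws F0 mF sz.
  elim: s th => [//|i s' ih] th'.
  have mI : jmeas 0 (fun=> fun th => \int[Pr]_w F (w :: ws) th)%E.
    exact: jmeas_fix sz (jmeas_int Pr F0 mF).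
  rewrite unif_iterS//; last by move=> ?; apply: integral_ge0.
  under [RHS]eq_integral do rewrite -ih.
  transitivity (\int[Pr]_w \int[uniform_prob NBB]_t unif_iter B s' (F (w :: ws)) (upd th' i t))%E.
    apply: eq_integral => w _; rewrite unif_iterS//.
    by apply: (@jmeas_fix n.+1 F (w :: ws) _ mF); rewrite /= sz.
  apply: (@fubini_upd Pr (uniform_prob NBB) n (fun ws th => unif_iter B s' (F ws) th)) => //.
  + by move=> *; exact: unif_iter_ge0.
  + exact: unif_iter_jmeas.
Qed.

End joint_measurability.

(** * The prior as an integral functional of total mass one *)

Section prior_functional.
Context (R : realType) (p L r : nat) d (Omega : measurableType d).
Variable Pr : probability Omega R.
Local Notation Theta := (Idx p L r -> R).
Local Notation ifun := (@integral_functional R p L r d Omega Pr).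

Lemma jmeas_cst n (c : \bar R) : @jmeas R p L r d Omega n (fun _ _ => c).
Proof. by move=> *; exact: measurable_cst. Qed.

Lemma integral_functional0 : ifun (fun=> 0%E).
Proof.
split=> //.
- by move=> *; rewrite adde0.
- by move=> *; rewrite mule0.
- by move=> *; exact: jmeas_cst.
- by move=> *; rewrite integral0.
Qed.

Lemma integral_functionalD J1 J2 : ifun J1 -> ifun J2 -> ifun (fun h => J1 h + J2 h)%E.
Proof.
move=> i1 i2; split.
- by move=> h h0; rewrite adde_ge0//; [exact: (if_ge0 i1)|exact: (if_ge0 i2)].
- by move=> *; apply: leeD; [exact: (if_le i1)|exact: (if_le i2)].
- by move=> *; rewrite (if_add i1)// (if_add i2)// addeACA.
- move=> k h k0 h0 mh; rewrite (if_scale i1)// (if_scale i2)// ge0_muleDr//;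
    [exact: (if_ge0 i1)|exact: (if_ge0 i2)].
- move=> n F F0 mF d' S ps ph mps mph; apply: emeasurable_funD.
    exact: (if_jmeas i1 F0 mF mps mph).
  exact: (if_jmeas i2 F0 mF mps mph).
- move=> n F ws F0 mF sz.
  rewrite -(if_swap i1 F0 mF sz) -(if_swap i2 F0 mF sz).
  have m J : ifun J -> measurable_fun setT (fun w => J (F (w :: ws))).
    by move=> iJ; exact: (jmeas_section (fun=> 0) (if_jmeas iJ F0 mF) sz).
  rewrite ge0_integralD//; try exact: m.
  + by move=> w _; exact: (if_ge0 i1).
  + by move=> w _; exact: (if_ge0 i2).
Qed.

Lemma integral_functionalZ (k : R) J : 0 <= k -> ifun J -> ifun (fun h => k%:E * J h)%E.
Proof.
move=> k0 iJ; split.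
- by move=> h h0; rewrite mule_ge0//; exact: (if_ge0 iJ).
- by move=> *; apply: lee_wpmul2l => //; exact: (if_le iJ).
- by move=> *; rewrite (if_add iJ)// ge0_muleDr//; exact: (if_ge0 iJ).
- by move=> *; rewrite (if_scale iJ)// muleCA.
- move=> n F F0 mF d' S ps ph mps mph; apply: measurable_funeM.
  exact: (if_jmeas iJ F0 mF mps mph).
- move=> n F ws F0 mF sz.
  rewrite -(if_swap iJ F0 mF sz) ge0_integralZl_EFin//.
    by move=> w _; exact: (if_ge0 iJ).
  exact: (jmeas_section (fun=> 0) (if_jmeas iJ F0 mF) sz).
Qed.

Lemma integral_functional_sum (I : Type) (s : seq I) (P : pred I)
    (J : I -> (Theta -> \bar R) -> \bar R) :
  (forall i, P i -> ifun (J i)) -> ifun (fun h => \sum_(i <- s | P i) J i h)%E.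
Proof.
move=> iJ; elim: s => [|i s ih].
  by under eq_fun do rewrite big_nil; exact: integral_functional0.
case Pi : (P i); under eq_fun do rewrite big_cons Pi; last exact: ih.
exact: integral_functionalD (iJ i Pi) ih.
Qed.

Variable B : R.
Hypothesis B1 : 1 <= B.

Let B0 : 0 < B. Proof. exact: lt_le_trans B1. Qed.

Lemma prior_weight_ge0 (P i : nat) : 0 <= (2%:R ^- i) / 'C(P, i)%:R / (1 - 2%:R ^- P) :> R.
Proof.
rewrite !divr_ge0// ?invr_ge0 ?exprn_ge0// subr_ge0 invf_le1 ?exprn_gt0//.
by rewrite exprn_ege1// ler1n.
Qed.

Lemma int_prior_functional : ifun (@int_prior R p L r B).
Proof.
apply: integral_functional_sum => i _; apply: integral_functionalZ.
  exact: prior_weight_ge0.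
apply: integral_functional_sum => I _; exact: unif_iter_functional.
Qed.

Lemma geometric_half (P : nat) : \sum_(1 <= i < P.+1) (2%:R ^- i : R) = 1 - 2%:R ^- P.
Proof.
elim: P => [|P ih]; first by rewrite big_geq// expr0 invr1 subrr.
by rewrite big_nat_recr//= ih exprS invfM; lra.
Qed.

Lemma int_prior1 : (0 < #|Idx p L r|)%N -> @int_prior R p L r B (fun=> 1%:E) = 1%:E.
Proof.
set P := #|_| => P0; rewrite /int_prior -/P.
have c0 : 1 - 2%:R ^- P != 0 :> R.
  rewrite subr_eq0 eq_sym lt_eqF// invf_lt1 ?exprn_gt0//.
  by rewrite exprn_egt1// ?ltr1n// -lt0n.
transitivity (((1 - 2%:R ^- P) / (1 - 2%:R ^- P) : R)%:E); last by rewrite mulfV.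
rewrite -[in X in (X / _)%:E]geometric_half mulr_suml -sumEFin.
rewrite !big_nat; apply: eq_bigr => i /andP[i1 iP].
rewrite (eq_bigr (fun=> 1%:E)); last by move=> I _; rewrite /int_PiI (unif_iter_cst B0).
rewrite sumEFin -EFinM sumr_const; congr EFin.
have -> : #|[pred I : {set Idx p L r} | #|I| == i]| = 'C(P, i).
  by rewrite /P -card_draws cardsE.
have ? : 'C(P, i)%:R != 0 :> R by rewrite pnatr_eq0 -lt0n bin_gt0 -ltnS.
by rewrite mulrAC divfK.
Qed.

Lemma leq_ffact_expn n m : (n ^_ m <= n ^ m)%N.
Proof.
elim: m => [|m ih]; first by rewrite ffactn0.
by rewrite ffactnSr expnSr leq_mul// leq_subr.
Qed.

(** Keep a single component of the mixture. Its weight is bounded below by 'C(P, i) <= P^i and a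
    normalising constant at most 1, so choosing the support costs a factor 2P per active
    coordinate. *)
Lemma int_prior_ge (I : {set Idx p L r}) h : I != finset.set0 ->
  (forall th, 0 <= h th)%E ->
  ((2%:R ^- #|I| / #|Idx p L r|%:R ^+ #|I|)%:E * int_PiI B I h <= int_prior B h)%E.
Proof.
move=> I0 h0; rewrite /int_prior; set P := #|Idx p L r|.
have u0 I' : (0 <= int_PiI B I' h)%E by exact: unif_iter_ge0.
have cI : (1 <= #|I| < P.+1)%N by rewrite card_gt0 I0/= ltnS max_card.
rewrite (bigD1_seq #|I|) ?iota_uniq//=; last by rewrite mem_index_iota.
rewrite (bigD1 I)//=; apply: lee_paddr.
  apply: sume_ge0 => i _; apply: mule_ge0; first by rewrite lee_fin prior_weight_ge0.
  by apply: sume_ge0.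
rewrite ge0_muleDr//; last by apply: sume_ge0.
apply: lee_paddr.
  apply: mule_ge0; first by rewrite lee_fin prior_weight_ge0.
  by apply: sume_ge0.
apply: lee_wpmul2r => //; rewrite lee_fin.
have P0 : (0 < P)%N by case/andP: cI => a b; exact: leq_trans a (ltnSE b).
have h1 : 0 < 1 - 2%:R ^- P :> R.
  by rewrite subr_gt0 invf_lt1 ?exprn_gt0// exprn_egt1// ?ltr1n// -lt0n.
have h2 : 1 - 2%:R ^- P <= 1 :> R by rewrite gerBl invr_ge0 exprn_ge0.
have h3 : ('C(P, #|I|) <= P ^ #|I|)%N.
  apply: leq_trans (leq_ffact_expn P #|I|).
  by rewrite -bin_ffact leq_pmulr// fact_gt0.
have C0 : (0 < 'C(P, #|I|))%N by rewrite bin_gt0 -ltnS; case/andP: cI.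
apply: (@le_trans _ _ (2 ^- #|I| / 'C(P, #|I|)%:R)).
  rewrite ler_wpM2l ?invr_ge0 ?exprn_ge0// lef_pV2 ?posrE ?ltr0n ?exprn_gt0 ?ltr0n//.
  by rewrite -natrX ler_nat.
rewrite ler_pdivlMr// ler_piMr// divr_ge0// invr_ge0 exprn_ge0//.
Qed.

End prior_functional.

(** * Prior mass of a neighbourhood of the oracle *)

Section box.
Context (R : realType) (p L r : nat) (B eta : R).
Hypotheses (B1 : 1 <= B) (eta0 : 0 < eta) (eta1 : eta <= 1).
Variables (I : {set Idx p L r}) (ths : Idx p L r -> R).
Hypothesis SI : S_I B I ths.

Let B0 : 0 < B. Proof. exact: lt_le_trans B1. Qed.

(* A one-sided interval around the centre, so that it stays inside [-B, B]. *)
Definition box_lo (i : Idx p L r) : R :=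
  if i \in I then (if 0 <= ths i then ths i - eta else ths i) else 0.
Definition box_hi (i : Idx p L r) : R :=
  if i \in I then (if 0 <= ths i then ths i else ths i + eta) else 0.

Definition box : set (Idx p L r -> R) := [set th | forall i, box_lo i <= th i <= box_hi i].

Lemma box_close th i : box th -> `|th i - ths i| <= eta.
Proof.
move=> /(_ i); rewrite /box_lo /box_hi; have [_ h] := SI i.
rewrite ler_norml; case: ifPn => [iI|/h ->]; last by move: eta0; lra.
by case: ifPn => _ /andP[a b]; move: eta0; lra.
Qed.

Lemma jmeas_indic d (Omega : measurableType d) n (A : set (Idx p L r -> R)) :
  (forall d' (S : measurableType d') (ph : S -> Idx p L r -> R),
     (forall i, measurable_fun setT (fun s => ph s i)) -> measurable (ph @^-1` A)) ->
  @jmeas R p L r d Omega n (fun _ th => (\1_A th)%:E).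
Proof.
move=> mA d' S ps ph mps mph; apply/measurable_EFinP.
rewrite (_ : (fun s => _) = \1_(ph @^-1` A)); first exact: measurable_indic (mA _ _ _ mph).
by apply/funext => s; rewrite !indicE; congr (_%:R); apply/idP/idP; rewrite !inE.
Qed.

Lemma measurable_box d' (S : measurableType d') (ph : S -> Idx p L r -> R) :
  (forall i, measurable_fun setT (fun s => ph s i)) -> measurable (ph @^-1` box).
Proof.
move=> mph.
rewrite (_ : ph @^-1` box = \bigcap_(i in [set: Idx p L r]) ((fun s => ph s i) @^-1` `[box_lo i, box_hi i])).
  apply: fin_bigcap_measurable => // i _.
  by rewrite -[X in measurable X]setTI; exact: mph.
apply/seteqP; split => s /= h i; last by have := h i Logic.I; rewrite /= in_itv.
by move=> _; rewrite /= in_itv/=; exact: h.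
Qed.

(** Each coordinate still to be integrated contributes the uniform mass eta / (2B) of an interval of
    length eta. The condition on [th] records that all other coordinates are already in place, which
    makes the induction close under [upd]. *)
Lemma box_mass s th : (forall j, j \notin s -> box_lo j <= th j <= box_hi j) ->
  {subset s <= I} ->
  (((eta / (2 * B)) ^+ size s)%:E <= unif_iter B s (fun th => (\1_box th)%:E) th)%E.
Proof.
have i0 th' : (0 <= (\1_box th' : R)%:E)%E by rewrite lee_fin.
have mb : @jmeas R p L r _ R 0 (fun _ th => (\1_box th)%:E).
  by apply: jmeas_indic; exact: measurable_box.
elim: s th => [|i s ih] th hth sI.
  by rewrite /= expr0 indicE mem_set// => j; exact: hth.
have iI : i \in I by apply: sI; rewrite inE eqxx.
have [hB _] := SI i; have /andP[hB1 hB2] := hB iI.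
rewrite /= exprS mulrAC EFinM muleC; apply: lee_wpmul2l.
  by rewrite lee_fin invr_ge0 mulr_ge0// ltW.
set c := (eta / (2 * B)) ^+ size s.
have c0 : 0 <= c by rewrite exprn_ge0// divr_ge0// ?mulr_ge0// ltW.
have mg : measurable_fun setT (fun t => unif_iter B s (fun th => (\1_box th)%:E) (upd th i t)).
  exact: (measurable_upd1 i th (unif_iter_jmeas B0 s (fun=> i0) mb)).
apply: (@le_trans _ _ (\int[lebesgue_measure]_(t in `[box_lo i, box_hi i]) c%:E)%E).
  rewrite (integral_cst _ _ c%:E)//= [X in (_ * X)%E]lebesgue_measure_itv /= lte_fin.
  have -> : box_lo i < box_hi i.
    by rewrite /box_lo /box_hi iI; case: ifPn => _; move: eta0; lra.
  rewrite -EFinB -EFinM mulrC lee_fin ler_wpM2l//.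
  by rewrite /box_lo /box_hi iI; case: ifPn => _; lra.
apply: (@le_trans _ _ (\int[lebesgue_measure]_(t in `[box_lo i, box_hi i])
    unif_iter B s (fun th => (\1_box th)%:E) (upd th i t))%E).
  apply: ge0_le_integral => //.
  - exact: measurable_funTS.
  - move=> t; rewrite /= in_itv/= => ht; apply: ih => [j js|j js]; last first.
      by apply: sI; rewrite inE js orbT.
    rewrite /upd; case: eqVneq => [->//|ji].
    by apply: hth; rewrite inE negb_or ji.
apply: ge0_subset_integral => //.
- exact: measurable_funTS.
- by move=> t _; exact: unif_iter_ge0.
(* The interval extends from the centre in the direction of zero; it may overshoot zero, but by at
   most eta <= 1 <= B. *)
move=> t; rewrite /= !in_itv/= /box_lo /box_hi iI; case: ifPn => h /andP[a b]; apply/andP.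
- by split; move: hB2 eta1 B1; lra.
- by split; move: h; rewrite -ltNge => h; move: hB1 eta1 B1; lra.
Qed.

End box.

(** * Iterated integrals over the sample *)

Section iterated_integral.
Context (R : realType) (p L r : nat) d (Omega : measurableType d).
Variable Pr : probability Omega R.
Local Notation Theta := (Idx p L r -> R).
Implicit Types (F : seq Omega -> Theta -> \bar R) (th : Theta).

(** [jmeas_int] integrates out the head of the sample, whereas [iter_int_jmeas] must integrate the
    observation that follows a fixed prefix; this rotation moves the head to the end of that
    prefix. *)
Lemma jmeas_rcons n F : jmeas n.+1 F ->
  jmeas n.+1 (fun ws => F (rcons (behead ws) (head point ws))).
Proof.
move=> mF d' S ps ph mps mph.
pose ps' k := if k == n then ps 0%N else ps k.+1.
have E s : mkseq (ps' ^~ s) n.+1 =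
    rcons (behead (mkseq (ps ^~ s) n.+1)) (head point (mkseq (ps ^~ s) n.+1)).
  rewrite mkseqS mkseq_cons /= {2}/ps' eqxx; congr rcons.
  apply/eq_in_map => k; rewrite mem_iota add0n /= => kn.
  by rewrite /ps' ltn_eqF.
under eq_fun do rewrite -E; apply: mF => // k.
by rewrite /ps'; case: (k == n).
Qed.

Lemma iter_int_ge0 n (G : seq Omega -> \bar R) : (forall ws, 0 <= G ws)%E ->
  (0 <= iter_int Pr n G)%E.
Proof.
elim: n G => [|n ih] G G0 //=.
by apply: integral_ge0 => w _; apply: ih.
Qed.

Lemma iter_int_jmeas n m F : (forall ws th, 0 <= F ws th)%E -> jmeas (m + n) F ->
  jmeas m (fun ws th => iter_int Pr n (fun s => F (ws ++ s) th)).
Proof.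
move=> F0; elim: n m => [|n ih] m mF /=.
  rewrite addn0 in mF; apply: jmeas_eq mF => ws th _; by rewrite cats0.
have mH : jmeas m.+1 (fun ws th => iter_int Pr n (fun s => F (ws ++ s) th)).
  by apply: ih; rewrite addSnnS.
apply: jmeas_eq (jmeas_int Pr _ (jmeas_rcons mH)) => [ws th _|ws th].
  by apply: eq_integral => w _; congr iter_int; apply/funext => s /=; rewrite cat_rcons.
exact: iter_int_ge0.
Qed.

Lemma iter_int_measurable n F th : (forall ws th, 0 <= F ws th)%E -> jmeas n.+1 F ->
  measurable_fun setT (fun w => iter_int Pr n (fun s => F (w :: s) th)).
Proof.
move=> F0 mF; have h := @iter_int_jmeas n 1 F F0 mF.
exact: (jmeas_section (ws := [::]) th h erefl).
Qed.

Local Notation wmeas n G := (jmeas n (fun ws (_ : Theta) => G ws)).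

Lemma iter_int_le n (G1 G2 : seq Omega -> \bar R) : (forall ws, 0 <= G1 ws)%E ->
  (forall ws, 0 <= G2 ws)%E ->
  wmeas n G1 -> wmeas n G2 -> (forall ws, size ws = n -> G1 ws <= G2 ws)%E ->
  (iter_int Pr n G1 <= iter_int Pr n G2)%E.
Proof.
elim: n G1 G2 => [|n ih] G1 G2 G10 G20 m1 m2 le12 /=; first exact: le12.
apply: ge0_le_integral => //.
- by move=> w _; exact: iter_int_ge0.
- exact: (iter_int_measurable (fun=> 0) _ m1).
- exact: (iter_int_measurable (fun=> 0) _ m2).
- move=> w _; apply: ih => //; [exact: jmeas_behead m1|exact: jmeas_behead m2|].
  by move=> ws sz; apply: le12; rewrite /= sz.
Qed.

Lemma iter_intD n (G1 G2 : seq Omega -> \bar R) : (forall ws, 0 <= G1 ws)%E ->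
  (forall ws, 0 <= G2 ws)%E -> wmeas n G1 -> wmeas n G2 ->
  (iter_int Pr n (fun ws => G1 ws + G2 ws) = iter_int Pr n G1 + iter_int Pr n G2)%E.
Proof.
elim: n G1 G2 => [|n ih] G1 G2 G10 G20 m1 m2 //=.
rewrite -ge0_integralD//.
- apply: eq_integral => w _; apply: ih => //;
    [exact: jmeas_behead m1|exact: jmeas_behead m2].
- by move=> w _; exact: iter_int_ge0.
- exact: (iter_int_measurable (fun=> 0) _ m1).
- by move=> w _; exact: iter_int_ge0.
- exact: (iter_int_measurable (fun=> 0) _ m2).
Qed.

Lemma iter_intZ n (k : R) (G : seq Omega -> \bar R) : 0 <= k -> (forall ws, 0 <= G ws)%E ->
  wmeas n G -> (iter_int Pr n (fun ws => k%:E * G ws) = k%:E * iter_int Pr n G)%E.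
Proof.
move=> k0; elim: n G => [|n ih] G G0 mG //=.
rewrite -ge0_integralZl_EFin//.
- apply: eq_integral => w _; apply: ih => //; exact: jmeas_behead mG.
- by move=> w _; exact: iter_int_ge0.
- exact: (iter_int_measurable (fun=> 0) _ mG).
Qed.

Lemma iter_int_cst n (k : R) : iter_int Pr n (fun=> k%:E) = k%:E.
Proof.
by elim: n => [//|n ih] /=; under eq_integral do rewrite ih; rewrite intR_cst.
Qed.

Lemma iter_int_swap J n F : integral_functional Pr J ->
  (forall ws th, 0 <= F ws th)%E -> jmeas n F ->
  iter_int Pr n (fun ws => J (F ws)) = J (fun th => iter_int Pr n (fun ws => F ws th)).
Proof.
move=> iJ; elim: n F => [|n ih] F F0 mF //=.
under eq_integral do rewrite (ih (fun s => F (_ :: s)) (fun s => F0 _) (jmeas_behead _ mF)).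
apply: (if_swap iJ (n := 0%N) (ws := [::])
  (F := fun ws th => iter_int Pr n (fun s => F (ws ++ s) th))) => //.
  by move=> ws th; exact: iter_int_ge0.
exact: (iter_int_jmeas (m := 1)).
Qed.

Definition cmeas (e : Omega -> Theta -> R) := forall d' (S : measurableType d')
    (w : S -> Omega) (ph : S -> Theta),
  measurable_fun setT w -> (forall i, measurable_fun setT (fun s => ph s i)) ->
  measurable_fun setT (fun s => e (w s) (ph s)).

Lemma jmeas_prod n e : cmeas e ->
  jmeas n (fun ws th => (\prod_(w <- ws) e w th)%:E).
Proof.
move=> me d' S ps ph mps mph; apply/measurable_EFinP.
under eq_fun do rewrite /mkseq big_map.
by apply: measurable_prod => k _; exact: me.
Qed.

(** This is where independence and identical distribution enter: the expectation of a product over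
    the sample factors into one-observation integrals. *)
Lemma iter_int_prod_le n (e : Omega -> R) (b : R) : measurable_fun setT e ->
  (forall w, 0 <= e w) -> 0 <= b -> (\int[Pr]_w (e w)%:E <= b%:E)%E ->
  (iter_int Pr n (fun ws => (\prod_(w <- ws) e w)%:E) <= (b ^+ n)%:E)%E.
Proof.
move=> me e0 b0 eb.
have p0 (ws : seq Omega) : (0 <= (\prod_(w <- ws) e w)%:E)%E by rewrite lee_fin prodr_ge0.
have mp m : wmeas m (fun ws => (\prod_(w <- ws) e w)%:E).
  by apply: (@jmeas_prod m (fun w _ => e w)) => d' S w ph mw _; exact: measurableT_comp.
elim: n => [|n ih] /=; first by rewrite big_nil expr0.
rewrite (eq_integral (fun w =>
    (e w)%:E * iter_int Pr n (fun ws => (\prod_(w <- ws) e w)%:E))%E); last first.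
  move=> w _; rewrite -iter_intZ//.
  by congr iter_int; apply/funext => s; rewrite big_cons EFinM.
rewrite ge0_integralZr//; last 3 first.
- exact/measurable_EFinP.
- by move=> w _; rewrite lee_fin.
- exact: iter_int_ge0.
rewrite exprS EFinM; apply: lee_pmul => //; last exact: iter_int_ge0.
exact: intR_ge0.
Qed.

End iterated_integral.

(** * Lipschitz dependence of the network on its parameters *)

Section network.
Context (R : realType) (p L r : nat).
Local Notation Theta := (Idx p L r -> R).
Implicit Types (th : Theta).

Lemma measurable_affine d (S : measurableType d) n (W : S -> 'I_n -> R) (b : S -> R)
    (h : S -> 'I_n -> R) :
  (forall k, measurable_fun setT (fun s => W s k)) -> measurable_fun setT b ->
  (forall k, measurable_fun setT (fun s => h s k)) ->
  measurable_fun setT (fun s => \sum_(k < n) W s k * h s k + b s).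
Proof.
move=> mW mb mh; apply: measurable_funD => //.
by apply: measurable_sum => k; exact: measurable_funM.
Qed.

Lemma measurable_fnet (C : R) d (S : measurableType d) (x : S -> 'I_p -> R)
    (ph : S -> Theta) :
  (forall k, measurable_fun setT (fun s => x s k)) ->
  (forall i, measurable_fun setT (fun s => ph s i)) ->
  measurable_fun setT (fun s => fnet C (ph s) (x s)).
Proof.
move=> mx mph.
have mrelu (g : S -> R) : measurable_fun setT g -> measurable_fun setT (fun s => relu (g s)).
  by move=> mg; exact: measurable_maxr.
apply: measurable_maxr => //; apply: measurable_minr => //.
apply: (measurable_affine (W := fun s k => ph s (inr (inl k)))) => //.
have fold ms (h : S -> 'I_r -> R) : (forall j, measurable_fun setT (fun s => h s j)) ->
    forall j, measurable_fun setT
      (fun s => foldl (fun h m => hidden (ph s) m h) (h s) ms j).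
  elim: ms h => [|m ms ih] h mh //=.
  apply: (ih (fun s => hidden (ph s) m (h s))) => j; apply: mrelu.
  exact: (measurable_affine (W := fun s k => ph s (inl (inr (m, inl (j, k)))))).
apply: fold => j; apply: mrelu.
exact: (measurable_affine (W := fun s k => ph s (inl (inl (inl (j, k)))))).
Qed.

Lemma maxr_lip (c x y : R) : `|Num.max c x - Num.max c y| <= `|x - y|.
Proof.
have := ler_norm (x - y); have := ler_norm (y - x); rewrite (distrC y x) => h1 h2.
by rewrite ler_norml; have [] := leP c x; have [] := leP c y => a b;
   apply/andP; split; lra.
Qed.

Lemma minr_lip (c x y : R) : `|Num.min x c - Num.min y c| <= `|x - y|.
Proof.
have := ler_norm (x - y); have := ler_norm (y - x); rewrite (distrC y x) => h1 h2.
by rewrite ler_norml; have [] := leP x c; have [] := leP y c => a b;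
   apply/andP; split; lra.
Qed.

Lemma relu_lip (x y : R) : `|relu x - relu y| <= `|x - y|.
Proof. by rewrite /relu !(maxC _ 0); exact: maxr_lip. Qed.

Lemma relu_norm (x : R) : `|relu x| <= `|x|.
Proof.
have := relu_lip x 0; have -> : relu 0 = 0 :> R by rewrite /relu maxxx.
by rewrite !subr0.
Qed.

Lemma clip_lip (C x y : R) :
  `|Num.max (- C) (Num.min x C) - Num.max (- C) (Num.min y C)| <= `|x - y|.
Proof. exact: le_trans (maxr_lip _ _ _) (minr_lip _ _ _). Qed.

Lemma clip_bound (C x : R) : 0 <= C -> `|Num.max (- C) (Num.min x C)| <= C.
Proof.
move=> C0; rewrite ler_norml le_max lexx /= ge_max.
by rewrite ge_min lexx orbT andbT; lra.
Qed.

(** [Q] is the size of the network input. Activations grow linearly with it, and Q >= 1 lets the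
    bias be absorbed into the same scale. *)
Lemma affine_bound n (W h : 'I_n -> R) (b B Q H : R) :
  0 <= H -> 1 <= Q -> (forall k, `|W k| <= B) -> `|b| <= B ->
  (forall k, `|h k| <= H * Q) ->
  `|\sum_(k < n) W k * h k + b| <= (n%:R * (B * H) + B) * Q.
Proof.
move=> H0 Q1 WB bB hH; have B0 := le_trans (normr_ge0 _) bB.
apply: (le_trans (ler_normD _ _)); rewrite mulrDl; apply: lerD; last first.
  by apply: (le_trans bB); rewrite ler_peMr.
apply: (le_trans (ler_norm_sum _ _ _)).
apply: (@le_trans _ _ (\sum_(k < n) B * H * Q)).
  by apply: ler_sum => k _; rewrite normrM -mulrA ler_pM.
by rewrite sumr_const card_ord -[leLHS]mulr_natl !mulrA.
Qed.

(** Telescoping: W h - W' h' = (W - W') h + W' (h - h'), so one layer turns the growth constant [H]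
    and the sensitivity [D] of its input into a new sensitivity. *)
Lemma affine_lip n (W W' h h' : 'I_n -> R) (b b' B Q H D eta : R) :
  0 <= H -> 1 <= Q -> 0 <= D -> 0 <= eta -> 0 <= B ->
  (forall k, `|W' k| <= B) ->
  (forall k, `|W k - W' k| <= eta) -> `|b - b'| <= eta ->
  (forall k, `|h k| <= H * Q) -> (forall k, `|h k - h' k| <= D * eta * Q) ->
  `|\sum_(k < n) W k * h k + b - (\sum_(k < n) W' k * h' k + b')|
    <= (n%:R * (H + B * D) + 1) * eta * Q.
Proof.
move=> H0 Q1 D0 e0 B0 WB WW bb hH hh.
rewrite opprD addrACA -sumrB.
apply: (le_trans (ler_normD _ _)); rewrite !mulrDl mul1r; apply: lerD; last first.
  by apply: (le_trans bb); rewrite ler_peMr.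
apply: (le_trans (ler_norm_sum _ _ _)).
apply: (@le_trans _ _ (\sum_(k < n) (H + B * D) * eta * Q)).
  apply: ler_sum => k _.
  have -> : W k * h k - W' k * h' k = (W k - W' k) * h k + W' k * (h k - h' k) by ring.
  apply: (le_trans (ler_normD _ _)); rewrite !normrM !mulrDl; apply: lerD.
    have -> : H * eta * Q = eta * (H * Q) by ring.
    by rewrite ler_pM.
  have -> : B * D * eta * Q = B * (D * eta * Q) by ring.
  by rewrite ler_pM.
by rewrite sumr_const card_ord -[leLHS]mulr_natl !mulrA.
Qed.

(** The constants are chosen before the parameters, [eta] and [Q]. Their size is left open, since in
    the end they affect only how large the sample must be. *)
Lemma hidden_lip (B : R) (ms : seq 'I_(L.-1)) (H D : R) : 0 <= B -> 0 <= H -> 0 <= D ->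
  exists H' D' : R, [/\ 0 <= H', 0 <= D' &
   forall th th' eta Q h h', 0 <= eta -> 1 <= Q ->
    (forall i, `|th i| <= B) -> (forall i, `|th' i| <= B) ->
    (forall i, `|th i - th' i| <= eta) ->
    (forall k, `|h k| <= H * Q) -> (forall k, `|h k - h' k| <= D * eta * Q) ->
    let g := foldl (fun h m => hidden th m h) h ms in
    let g' := foldl (fun h m => hidden th' m h) h' ms in
    (forall k, `|g k| <= H' * Q) /\ (forall k, `|g k - g' k| <= D' * eta * Q)].
Proof.
move=> B0; elim: ms H D => [|m ms ih] H D H0 D0.
  by exists H, D; split.
have H1 : 0 <= r%:R * (B * H) + B by rewrite addr_ge0// !mulr_ge0.
have D1 : 0 <= r%:R * (H + B * D) + 1 by rewrite addr_ge0// mulr_ge0// addr_ge0// mulr_ge0.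
have [H' [D' [H'0 D'0 h]]] := ih _ _ H1 D1.
exists H', D'; split=> // th th' eta Q hh hh' e0 Q1 thB thB' tt hH hD /=.
apply: h => //.
  by move=> k; rewrite /hidden; apply: (le_trans (relu_norm _)); exact: affine_bound.
by move=> k; rewrite /hidden; apply: (le_trans (relu_lip _ _)); exact: affine_lip.
Qed.

Lemma fnet_lip (B C : R) : 0 <= B ->
  exists2 M : R, 0 <= M & forall th th' eta Q x, 0 <= eta -> 1 <= Q ->
    (forall i, `|th i| <= B) -> (forall i, `|th' i| <= B) ->
    (forall i, `|th i - th' i| <= eta) -> (forall k, `|x k| <= Q) ->
    `|fnet C th x - fnet C th' x| <= M * eta * Q.
Proof.
move=> B0.
(* The first layer sees the same input under both parameters: growth constant 1 and sensitivity
   0. *)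
have H1 : 0 <= p%:R * (B * 1) + B :> R by rewrite addr_ge0// !mulr_ge0.
have D1 : 0 <= p%:R * (1 + B * 0) + 1 :> R by rewrite mulr0 addr0 mulr1 addr_ge0.
have [H' [D' [H'0 D'0 h]]] := hidden_lip (enum 'I_(L.-1)) B0 H1 D1.
exists (r%:R * (H' + B * D') + 1) => [|th th' eta Q x e0 Q1 thB thB' tt xQ].
  by rewrite addr_ge0// mulr_ge0// addr_ge0// mulr_ge0.
apply: (le_trans (clip_lip _ _ _)).
have xQ' k : `|x k| <= 1 * Q by rewrite mul1r.
have l1 k : `|layer1 th x k| <= (p%:R * (B * 1) + B) * Q.
  by apply: (le_trans (relu_norm _)); exact: affine_bound.
have l2 k : `|layer1 th x k - layer1 th' x k| <= (p%:R * (1 + B * 0) + 1) * eta * Q.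
  apply: (le_trans (relu_lip _ _)); apply: affine_lip => // j.
  by rewrite subrr normr0 !mul0r.
have [g1 g2] := h th th' eta Q (layer1 th x) (layer1 th' x) e0 Q1 thB thB' tt l1 l2.
by rewrite /gnet /outlayer; exact: affine_lip.
Qed.

End network.

(** * A PAC-Bayes bound in expectation *)

Section pac_bayes.
Context (R : realType) (p L r : nat) d (Omega : measurableType d).
Variable Pr : probability Omega R.
Local Notation Theta := (Idx p L r -> R).
Variable J : (Theta -> \bar R) -> \bar R.
Hypothesis iJ : integral_functional Pr J.
Hypothesis J1 : J (fun=> 1%:E) = 1%:E.

Lemma jmeasM n (a b : seq Omega -> Theta -> R) :
  jmeas n (fun ws th => (a ws th)%:E) -> jmeas n (fun ws th => (b ws th)%:E) ->
  jmeas n (fun ws th => (a ws th * b ws th)%:E).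
Proof.
move=> ma mb d' S ps ph mps mph; apply/measurable_EFinP.
by apply: measurable_funM; apply/measurable_EFinP; [exact: ma|exact: mb].
Qed.

Lemma jmeasD n (a b : seq Omega -> Theta -> \bar R) :
  jmeas n a -> jmeas n b -> jmeas n (fun ws th => a ws th + b ws th)%E.
Proof.
by move=> ma mb d' S ps ph mps mph; apply: emeasurable_funD; [exact: ma|exact: mb].
Qed.

Lemma jmeasZ n (k : R) (a : seq Omega -> Theta -> \bar R) :
  jmeas n a -> jmeas n (fun ws th => k%:E * a ws th)%E.
Proof. by move=> ma d' S ps ph mps mph; apply: measurable_funeM; exact: ma. Qed.

Lemma functional_cst (k : R) : 0 <= k -> J (fun=> k%:E) = k%:E.
Proof.
have i0 (th : Theta) : (0 <= 1%:E :> \bar R)%E by [].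
move=> k0; rewrite -[RHS]mule1 -J1 -(if_scale iJ k0 i0 (jmeas_cst _ _)).
by congr J; apply/funext => th; rewrite mule1.
Qed.

Lemma functional_fin (h : Theta -> R) (k : R) :
  (forall th, 0 <= h th <= k) -> jmeas 0 (fun (_ : seq Omega) th => (h th)%:E) ->
  (J (fun th => (h th)%:E))%E = (fine (J (fun th => (h th)%:E)))%:E.
Proof.
move=> hk mh; rewrite fineK// ge0_fin_numE; last first.
  by apply: (if_ge0 iJ) => th; rewrite lee_fin; case/andP: (hk th).
apply: le_lt_trans (ltry k).
have k0 : 0 <= k by case/andP: (hk (fun=> 0)) => a b; exact: le_trans a b.
rewrite -(functional_cst k0); apply: (if_le iJ) => //.
- by move=> th; rewrite lee_fin; case/andP: (hk th).
- by move=> th; rewrite lee_fin; case/andP: (hk th).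
Qed.

Variables (z : Omega -> Theta -> R) (bnd : Omega -> R) (t : R).
Hypothesis mz : cmeas z.
Hypothesis t0 : 0 < t.
Hypothesis zb : forall w th, `|z w th| <= bnd w.

Let W ws th : R := \prod_(w <- ws) expR (- t * z w th).
Let Wi ws th : R := \prod_(w <- ws) expR (t * z w th).

Let cm (c : R) : cmeas (fun w th => expR (c * z w th)).
Proof.
move=> d' S w ph mw mph; apply: measurableT_comp => //.
by apply: measurable_funM => //; exact: mz.
Qed.

Let mW n : jmeas n (fun ws th => (W ws th)%:E).
Proof. exact: jmeas_prod. Qed.
Let mWi n : jmeas n (fun ws th => (Wi ws th)%:E).
Proof. exact: jmeas_prod. Qed.

(** An envelope at a fixed sample, uniform in the parameter: all weights lie between its inverse and
    itself, so the prior integrals are finite and the normalising constant is positive. *)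
Let K ws : R := expR (t * \sum_(w <- ws) bnd w).

Let prod_le (c : R) ws th : `|c| = t -> \prod_(w <- ws) expR (c * z w th) <= K ws.
Proof.
move=> ct; rewrite /K mulr_sumr expR_sum; apply: ler_prod => w _.
rewrite expR_ge0 ler_expR/=; apply: (le_trans (ler_norm _)).
by rewrite normrM ct ler_wpM2l// ltW.
Qed.

Let W_gt0 ws th : 0 < W ws th. Proof. by apply: prodr_gt0 => w _; exact: expR_gt0. Qed.
Let Wi_gt0 ws th : 0 < Wi ws th. Proof. by apply: prodr_gt0 => w _; exact: expR_gt0. Qed.
Let W_le ws th : W ws th <= K ws. Proof. by apply: prod_le; rewrite normrN gtr0_norm. Qed.
Let Wi_le ws th : Wi ws th <= K ws. Proof. by apply: prod_le; rewrite gtr0_norm. Qed.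

Let WWi ws th : W ws th * Wi ws th = 1.
Proof.
rewrite /W /Wi -big_split/= big1// => w _.
by rewrite -expRD mulNr addNr expR0.
Qed.

Let K_gt0 ws : 0 < K ws. Proof. exact: expR_gt0. Qed.

Let W_ge ws th : (K ws)^-1 <= W ws th.
Proof.
have <- : (Wi ws th)^-1 = W ws th.
  by apply/esym/eqP; rewrite -(mulr1 _^-1) -(WWi ws th) mulrC mulfK// gt_eqF.
by rewrite lef_pV2// posrE.
Qed.

Let Wi_ge ws th : (K ws)^-1 <= Wi ws th.
Proof.
have <- : (W ws th)^-1 = Wi ws th.
  by apply/esym/eqP; rewrite -(mulr1 _^-1) -(WWi ws th) mulKf// gt_eqF.
by rewrite lef_pV2// posrE.
Qed.

Variables (A U : set Theta).
Hypothesis mA : forall d' (S : measurableType d') (ph : S -> Theta),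
  (forall i, measurable_fun setT (fun s => ph s i)) -> measurable (ph @^-1` A).
Hypothesis mU : forall d' (S : measurableType d') (ph : S -> Theta),
  (forall i, measurable_fun setT (fun s => ph s i)) -> measurable (ph @^-1` U).

Let m1A n : @jmeas R p L r d Omega n (fun _ th => (\1_A th)%:E).
Proof. exact: jmeas_indic. Qed.
Let m1U n : @jmeas R p L r d Omega n (fun _ th => (\1_U th)%:E).
Proof. exact: jmeas_indic. Qed.
Let m1Ac n : @jmeas R p L r d Omega n (fun _ th => (\1_(~` A) th)%:E).
Proof.
apply: jmeas_indic => d' S ph mph; rewrite preimage_setC; apply: measurableC.
exact: mA.
Qed.

Let ind01 (B : set Theta) th : 0 <= (\1_B th : R) <= 1.
Proof. by rewrite indicE; case: (_ \in _) => /=; rewrite ?lexx ?ler01. Qed.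

Definition posterior ws : R :=
  fine (J (fun th => (\1_A th * W ws th)%:E)) / fine (J (fun th => (W ws th)%:E)).

Let Zr ws := fine (J (fun th => (W ws th)%:E)).
Let Nr ws := fine (J (fun th => (\1_(~` A) th * W ws th)%:E)).
Let Ar ws := fine (J (fun th => (\1_A th * W ws th)%:E)).
Let Vr ws := fine (J (fun th => (\1_U th * Wi ws th)%:E)).
Let kap := fine (J (fun th => (\1_U th)%:E)).

Let indM_bd (B : set Theta) (h k : R) th : 0 <= h <= k -> 0 <= \1_B th * h <= k.
Proof.
move=> /andP[h0 hk]; have /andP[i0 i1] := ind01 B th.
by rewrite mulr_ge0//= (le_trans _ hk)// ler_piMl.
Qed.

Let W_bd ws th : 0 <= W ws th <= K ws. Proof. by rewrite W_le ltW. Qed.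
Let Wi_bd ws th : 0 <= Wi ws th <= K ws. Proof. by rewrite Wi_le ltW. Qed.

Let fixj (F : seq Omega -> Theta -> \bar R) (ws : seq Omega) :
  (forall n, jmeas n F) -> jmeas 0 (fun _ : seq Omega => F ws).
Proof. by move=> h; exact: jmeas_fix erefl (h _). Qed.

Let ZE ws : J (fun th => (W ws th)%:E) = (Zr ws)%:E.
Proof. by apply: (functional_fin (W_bd ws)); exact: (fixj _ mW). Qed.
Let NE ws : J (fun th => (\1_(~` A) th * W ws th)%:E) = (Nr ws)%:E.
Proof.
apply: (@functional_fin (fun th => \1_(~` A) th * W ws th) (K ws)).
  by move=> th; exact: indM_bd.
by apply: (fixj (F := fun ws th => (\1_(~` A) th * W ws th)%:E)) => n; exact: jmeasM.
Qed.
Let AE ws : J (fun th => (\1_A th * W ws th)%:E) = (Ar ws)%:E.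
Proof.
apply: (@functional_fin (fun th => \1_A th * W ws th) (K ws)).
  by move=> th; exact: indM_bd.
by apply: (fixj (F := fun ws th => (\1_A th * W ws th)%:E)) => n; exact: jmeasM.
Qed.
Let VE ws : J (fun th => (\1_U th * Wi ws th)%:E) = (Vr ws)%:E.
Proof.
apply: (@functional_fin (fun th => \1_U th * Wi ws th) (K ws)).
  by move=> th; exact: indM_bd.
by apply: (fixj (F := fun ws th => (\1_U th * Wi ws th)%:E)) => n; exact: jmeasM.
Qed.
Let kapE : J (fun th => (\1_U th)%:E) = kap%:E.
Proof. exact: (functional_fin (ind01 U)). Qed.

Let pos_fine (h : Theta -> \bar R) : (forall th, 0 <= h th)%E -> 0 <= fine (J h).
Proof. by move=> h0; apply: fine_ge0; exact: (if_ge0 iJ). Qed.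

Let Z_gt0 ws : 0 < Zr ws.
Proof.
have K0 : 0 < (K ws)^-1 by rewrite invr_gt0.
apply: (lt_le_trans K0); rewrite -lee_fin -ZE -(functional_cst (ltW K0)).
apply: (if_le iJ) => //.
- by move=> th; rewrite lee_fin ltW.
- exact: (fixj _ mW).
- by move=> th; rewrite lee_fin.
Qed.

Let ind_ge0 (B : set Theta) (h : R) th : 0 <= h -> 0 <= \1_B th * h.
Proof. by move=> h0; have /andP[i0 _] := ind01 B th; exact: mulr_ge0. Qed.

Let A_ge0 ws : 0 <= Ar ws.
Proof. by apply: pos_fine => th; rewrite lee_fin ind_ge0// ltW. Qed.
Let N_ge0 ws : 0 <= Nr ws.
Proof. by apply: pos_fine => th; rewrite lee_fin ind_ge0// ltW. Qed.

Let ANZ ws : Ar ws + Nr ws = Zr ws.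
Proof.
apply: EFin_inj; rewrite EFinD -AE -NE -ZE -(if_add iJ).
- congr J; apply/funext => th; rewrite -EFinD -mulrDl; congr EFin.
  rewrite !indicE in_setC; case: (th \in A) => /=; by rewrite ?addr0 ?add0r mul1r.
- by move=> th; rewrite lee_fin ind_ge0// ltW.
- by move=> th; rewrite lee_fin ind_ge0// ltW.
- by apply: (fixj (F := fun ws th => (\1_A th * W ws th)%:E)) => n; exact: jmeasM.
- by apply: (fixj (F := fun ws th => (\1_(~` A) th * W ws th)%:E)) => n; exact: jmeasM.
Qed.

Hypothesis kap_gt0 : 0 < kap.

Let V_gt0 ws : 0 < Vr ws.
Proof.
have K0 : 0 < (K ws)^-1 by rewrite invr_gt0.
apply: (@lt_le_trans _ _ ((K ws)^-1 * kap)); first by rewrite mulr_gt0.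
have U0 th : (0 <= (\1_U th : R)%:E)%E by rewrite lee_fin; case/andP: (ind01 U th).
rewrite -lee_fin -VE EFinM -kapE -(if_scale iJ (ltW K0) U0 (m1U 0)).
apply: (if_le iJ) => //.
- by move=> th; rewrite -EFinM lee_fin mulr_ge0 ?(ltW K0).
- by apply: (@jmeasZ 0 _ (fun _ th => (\1_U th)%:E)); exact: m1U.
- by apply: (fixj (F := fun ws th => (\1_U th * Wi ws th)%:E)) => n; exact: jmeasM.
- by move=> th; rewrite -EFinM lee_fin mulrC ler_wpM2l.
Qed.

(* Harmonic-arithmetic mean inequality for the prior restricted to [U]. *)
Let Z_ge ws : kap ^+ 2 / Vr ws <= Zr ws.
Proof.
(* From W * Wi = 1 follows W + tau^2 Wi >= 2 tau for every tau. Integrating over [U] gives Z >= 2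
   tau kap - tau^2 V, and this tau maximises the right side. *)
set tau := kap / Vr ws.
have tau0 : 0 < tau by rewrite divr_gt0.
have mUW : jmeas 0 (fun (_ : seq Omega) th => (\1_U th * Wi ws th)%:E).
  by apply: (fixj (F := fun ws th => (\1_U th * Wi ws th)%:E)) => n; exact: jmeasM.
have tau20 : 0 <= 2 * tau by rewrite mulr_ge0// ltW.
have U0 th : (0 <= (\1_U th : R)%:E)%E by rewrite lee_fin; case/andP: (ind01 U th).
have UW0 th : (0 <= (\1_U th * Wi ws th)%:E)%E by rewrite lee_fin ind_ge0// ltW.
have sq0 : 0 <= tau ^+ 2 := sqr_ge0 tau.
have h : 2 * tau * kap <= Zr ws + tau ^+ 2 * Vr ws.
  rewrite -lee_fin EFinD [in leLHS]EFinM [in leRHS]EFinM -kapE -ZE -VE.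
  rewrite -(if_scale iJ tau20 U0 (m1U 0)) -(if_scale iJ sq0 UW0 mUW) -(if_add iJ)//.
  - apply: (if_le iJ).
    + by move=> th; rewrite mule_ge0// lee_fin.
    + by apply: (@jmeasZ 0 _ (fun _ th => (\1_U th)%:E)); exact: m1U.
    + apply: (@jmeasD 0 (fun _ th => (W ws th)%:E)); first exact: (fixj _ mW).
      exact: (@jmeasZ 0 _ (fun _ th => (\1_U th * Wi ws th)%:E)).
    + move=> th; rewrite -!EFinM -EFinD lee_fin indicE.
      case: (th \in U); rewrite ?mulr1 ?mul1r ?mul0r ?(mulr0, addr0); last exact: ltW.
      have e := WWi ws th; have w0 := Wi_gt0 ws th.
      have -> : W ws th + tau ^+ 2 * Wi ws th = 2 * tau + Wi ws th * (W ws th - tau) ^+ 2.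
        have -> : Wi ws th * (W ws th - tau) ^+ 2 = W ws th * (W ws th * Wi ws th)
          - 2 * tau * (W ws th * Wi ws th) + tau ^+ 2 * Wi ws th by ring.
        by rewrite e; ring.
      by rewrite lerDl mulr_ge0 ?sqr_ge0// ltW.
  - by move=> th; rewrite lee_fin ltW.
  - by move=> th; rewrite mule_ge0// lee_fin.
  - exact: (fixj _ mW).
  - exact: (@jmeasZ 0 _ (fun _ th => (\1_U th * Wi ws th)%:E)).
have e1 : tau * kap = kap ^+ 2 / Vr ws by rewrite /tau; field; rewrite gt_eqF.
have e2 : tau ^+ 2 * Vr ws = kap ^+ 2 / Vr ws by rewrite /tau; field; rewrite gt_eqF.
by move: h; rewrite e2 -mulrA e1; lra.
Qed.

Lemma posterior_ge (s : R) ws : 0 < s ->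
  1 <= posterior ws + s / 2 * Nr ws + (2 * kap ^+ 2 * s)^-1 * Vr ws.
Proof.
move=> s0; rewrite /posterior -/(Ar ws) -/(Zr ws).
have z0 := Z_gt0 ws; have n0 := N_ge0 ws; have a0 := A_ge0 ws; have v0 := V_gt0 ws.
have -> : Ar ws = Zr ws - Nr ws by rewrite -(ANZ ws) addrK.
rewrite mulrBl divff ?gt_eqF//.
set x := Nr ws / Zr ws.
have x0 : 0 <= x by rewrite divr_ge0// ltW.
have x1 : x <= 1 by rewrite ler_pdivrMr// mul1r -(ANZ ws) lerDr.
have nE : Nr ws = x * Zr ws by rewrite divfK ?gt_eqF.
set y := s / 2 * Nr ws; set v := _ * Vr ws.
have hv : (2 * s * Zr ws)^-1 <= v.
  have -> : v = (2 * s * (kap ^+ 2 / Vr ws))^-1 by rewrite /v; field; rewrite !gt_eqF.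
  rewrite lef_pV2 ?posrE ?mulr_gt0// ?exprn_gt0 ?invr_gt0//.
  by rewrite ler_wpM2l ?mulr_ge0 ?(ltW s0).
suff : x <= y + (2 * s * Zr ws)^-1 by move: hv; lra.
(* Here y q = x / 4, so (y + q)^2 >= 4 y q = x >= x^2, the last step because x is a probability. *)
set q := (2 * s * Zr ws)^-1.
have q0 : 0 < q by rewrite invr_gt0 !mulr_gt0.
have yq : y * q = x / 4 by rewrite /y /q nE; field; rewrite !gt_eqF.
have y0 : 0 <= y by rewrite mulr_ge0// divr_ge0// ltW.
have h : x <= (y + q) ^+ 2.
  have -> : (y + q) ^+ 2 = (y - q) ^+ 2 + 4 * (y * q) by ring.
  by have := sqr_ge0 (y - q); rewrite yq; lra.
rewrite -(ler_sqr _ _) ?nnegrE ?addr_ge0 ?(ltW q0)//.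
by apply: le_trans h; rewrite expr2 ler_piMl.
Qed.

Lemma posterior_ge0 ws : 0 <= posterior ws.
Proof. by rewrite /posterior -/(Ar ws) -/(Zr ws) divr_ge0// ltW. Qed.

Lemma jmeas_posterior n : jmeas n (fun ws (_ : Theta) => (posterior ws)%:E).
Proof.
(* Positivity of the normalising constant turns the inverse into a composition of measurable
   functions. *)
have E ws : posterior ws = Ar ws * expR (- ln (Zr ws)).
  by rewrite expRN lnK ?posrE.
move=> d' S ps ph mps mph; apply/measurable_EFinP; under eq_fun do rewrite E.
have mA' : jmeas n (fun ws th => (\1_A th * W ws th)%:E) by exact: jmeasM.
have A0 ws th : (0 <= (\1_A th * W ws th)%:E)%E by rewrite lee_fin ind_ge0// ltW.
have W0 ws th : (0 <= (W ws th)%:E)%E by rewrite lee_fin ltW.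
apply: measurable_funM.
  exact: measurableT_comp (if_jmeas iJ A0 mA' mps mph).
do 3 apply: measurableT_comp => //.
exact: measurableT_comp (if_jmeas iJ W0 (mW n) mps mph).
Qed.

(** The Gibbs weights are built from the full squared loss and differ from [W] by a factor that
    depends on the noise but not on the parameter; it cancels in the normalisation. *)
Lemma posterior_scale (c : R) ws : 0 < c ->
  fine (J (fun th => (\1_A th * (c * W ws th))%:E)) /
  fine (J (fun th => (c * W ws th)%:E)) = posterior ws.
Proof.
move=> c0; have mAW : jmeas 0 (fun (_ : seq Omega) th => (\1_A th * W ws th)%:E).
  by apply: (fixj (F := fun ws th => (\1_A th * W ws th)%:E)) => n; exact: jmeasM.
have AW0 th : (0 <= (\1_A th * W ws th)%:E)%E by rewrite lee_fin ind_ge0// ltW.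
have W0 th : (0 <= (W ws th)%:E)%E by rewrite lee_fin ltW.
under [in X in fine X / _]eq_fun do rewrite mulrCA EFinM.
under [in X in _ / fine X]eq_fun do rewrite EFinM.
rewrite (if_scale iJ (ltW c0) AW0 mAW) (if_scale iJ (ltW c0) W0 (fixj _ mW)).
rewrite AE ZE /posterior AE ZE /=; have := Z_gt0 ws => z0.
by field; rewrite !gt_eqF.
Qed.

Variables (E : Theta -> R) (a b T S : R).
Hypothesis AE' : forall th, ~ A th -> T < E th.
Hypothesis US : forall th, U th -> E th <= S.
Hypotheses (a0 : 0 <= a) (b0 : 0 <= b).
Hypothesis mgf_neg : forall th,
  (\int[Pr]_w (expR (- t * z w th))%:E <= (expR (- (a * E th)))%:E)%E.
Hypothesis mgf_pos : forall th,
  (\int[Pr]_w (expR (t * z w th))%:E <= (expR (b * E th))%:E)%E.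

Let mzw th (c : R) : measurable_fun setT (fun w => expR (c * z w th)).
Proof.
apply: measurableT_comp => //; apply: measurable_funM => //.
by apply: (mz (w := id) (ph := fun=> th)).
Qed.

(** After exchanging prior and sample expectation, each parameter is treated alone: inside [A] the
    integrand vanishes, outside it is a product of n factors of rate a E > a T. The prior has mass
    one, so the pointwise bound survives. *)
Let int_N n : (iter_int Pr n (fun ws => (Nr ws)%:E) <= (expR (- (n%:R * (a * T))))%:E)%E.
Proof.
pose F ws th := (\1_(~` A) th * W ws th)%:E.
have F0 ws th : (0 <= F ws th)%E by rewrite lee_fin ind_ge0// ltW.
have mF m : jmeas m F by exact: jmeasM.
rewrite (_ : (fun ws => _) = (fun ws => J (F ws))); last by apply/funext => ws; rewrite NE.
rewrite (iter_int_swap iJ F0 (mF n)) -(functional_cst (expR_ge0 _)).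
apply: (if_le iJ).
- by move=> th; exact: iter_int_ge0.
- exact: (iter_int_jmeas Pr (m := 0) F0 (mF n)).
- exact: jmeas_cst.
move=> th; rewrite /F.
have [Ath|nA] := pselect (A th).
  rewrite (_ : (fun ws => _) = (fun=> 0%:E)); first by rewrite iter_int_cst lee_fin expR_ge0.
  by apply/funext => ws; rewrite indicE in_setC mem_set//= mul0r.
rewrite (_ : (fun ws => _) = (fun ws => (W ws th)%:E)); last first.
  by apply/funext => ws; rewrite indicE in_setC memNset//= mul1r.
have h := iter_int_prod_le p L r n (mzw th (- t)) (fun w => expR_ge0 _) (expR_ge0 _) (mgf_neg th).
apply: (le_trans h); rewrite lee_fin -expRM_natl ler_expR mulrN lerN2.
by rewrite ler_wpM2l// ler_wpM2l// ltW// AE'.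
Qed.

Let int_V n : (iter_int Pr n (fun ws => (Vr ws)%:E) <= (kap * expR (n%:R * (b * S)))%:E)%E.
Proof.
pose F ws th := (\1_U th * Wi ws th)%:E.
have F0 ws th : (0 <= F ws th)%E by rewrite lee_fin ind_ge0// ltW.
have mF m : jmeas m F by exact: jmeasM.
rewrite (_ : (fun ws => _) = (fun ws => J (F ws))); last by apply/funext => ws; rewrite VE.
have U0 th : (0 <= (\1_U th : R)%:E)%E by rewrite lee_fin; case/andP: (ind01 U th).
rewrite (iter_int_swap iJ F0 (mF n)) mulrC EFinM -kapE.
rewrite -(if_scale iJ (expR_ge0 _) U0 (m1U 0)).
apply: (if_le iJ).
- by move=> th; exact: iter_int_ge0.
- exact: (iter_int_jmeas Pr (m := 0) F0 (mF n)).
- by apply: (@jmeasZ 0 _ (fun _ th => (\1_U th)%:E)); exact: m1U.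
move=> th; rewrite /F.
have [Uth|nU] := pselect (U th); last first.
  rewrite (_ : (fun ws => _) = (fun=> 0%:E)).
    have /andP[u0 _] := ind01 U th.
    rewrite iter_int_cst -EFinM lee_fin; apply: mulr_ge0 => //; exact: expR_ge0.
  by apply/funext => ws; rewrite indicE memNset//= mul0r.
rewrite (_ : (fun ws => _) = (fun ws => (Wi ws th)%:E)); last first.
  by apply/funext => ws; rewrite indicE mem_set//= mul1r.
have h := iter_int_prod_le p L r n (mzw th t) (fun w => expR_ge0 _) (expR_ge0 _) (mgf_pos th).
apply: (le_trans h); rewrite -EFinM indicE mem_set//= mulr1 lee_fin -expRM_natl ler_expR.
by rewrite ler_wpM2l// ler_wpM2l// US.
Qed.

(** With this [s] the numerator term is at most delta / 2. The denominator term is exp(n (b S - a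
    T)) / (2 kap delta): of the factor kap^-2, one kap is returned by the integral over [U]. Asking
    that it be at most delta / 2 is exactly the displayed condition. *)
Lemma pac_bayes n (delta : R) : 0 < delta ->
  expR (n%:R * (b * S - a * T)) <= kap * delta ^+ 2 ->
  ((1 - delta)%:E <= iter_int Pr n (fun ws => (posterior ws)%:E))%E.
Proof.
move=> d0 hd.
pose s := delta * expR (n%:R * (a * T)).
have s0 : 0 < s by rewrite mulr_gt0// expR_gt0.
pose c := (2 * kap ^+ 2 * s)^-1.
have c0 : 0 < c by rewrite invr_gt0 mulr_gt0// mulr_gt0// exprn_gt0.
have mN : jmeas n (fun ws (_ : Theta) => (Nr ws)%:E).
  apply: jmeas_eq (if_jmeas iJ (F := fun ws th => (\1_(~` A) th * W ws th)%:E) _ (jmeasM (m1Ac n) (mW n))).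
    by move=> ws th _; rewrite NE.
  by move=> ws th; rewrite lee_fin ind_ge0// ltW.
have mV : jmeas n (fun ws (_ : Theta) => (Vr ws)%:E).
  apply: jmeas_eq (if_jmeas iJ (F := fun ws th => (\1_U th * Wi ws th)%:E) _ (jmeasM (m1U n) (mWi n))).
    by move=> ws th _; rewrite VE.
  by move=> ws th; rewrite lee_fin ind_ge0// ltW.
have P0 ws : (0 <= (posterior ws)%:E)%E by rewrite lee_fin posterior_ge0.
have N0 ws : (0 <= (Nr ws)%:E)%E by rewrite lee_fin.
have V0 ws : (0 <= (Vr ws)%:E)%E by rewrite lee_fin ltW.
have sN0 ws : (0 <= (s / 2)%:E * (Nr ws)%:E)%E by rewrite mule_ge0// lee_fin divr_ge0// ltW.
have cV0 ws : (0 <= c%:E * (Vr ws)%:E)%E by rewrite mule_ge0// lee_fin ltW.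
have mP := jmeas_posterior n.
have msN : jmeas n (fun ws (_ : Theta) => (s / 2)%:E * (Nr ws)%:E)%E by exact: jmeasZ.
have mcV : jmeas n (fun ws (_ : Theta) => c%:E * (Vr ws)%:E)%E by exact: jmeasZ.
have sum : (1%:E <= iter_int Pr n (fun ws => (posterior ws)%:E) +
   (s / 2)%:E * iter_int Pr n (fun ws => (Nr ws)%:E) +
   c%:E * iter_int Pr n (fun ws => (Vr ws)%:E))%E.
  rewrite -(iter_intZ (p := p) (L := L) (r := r))//; last by rewrite divr_ge0// ltW.
  rewrite -(iter_intZ (p := p) (L := L) (r := r))//; last exact: ltW.
  rewrite -(iter_intD (p := p) (L := L) (r := r))//.
  rewrite -(iter_intD (p := p) (L := L) (r := r))//; last 2 first.
  - by move=> ws; rewrite adde_ge0.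
  - exact: jmeasD.
  rewrite -(iter_int_cst Pr n 1); apply: (iter_int_le (p := p) (L := L) (r := r)).
  - by move=> ws; rewrite lee_fin.
  - by move=> ws; rewrite !adde_ge0.
  - exact: jmeas_cst.
  - by apply: jmeasD => //; exact: jmeasD.
  - by move=> ws _; rewrite -!EFinM -!EFinD lee_fin; exact: posterior_ge.
have hN : ((s / 2)%:E * iter_int Pr n (fun ws => (Nr ws)%:E) <= (delta / 2)%:E)%E.
  have -> : delta / 2 = s / 2 * expR (- (n%:R * (a * T))).
    by rewrite /s expRN; field; rewrite gt_eqF// expR_gt0.
  by rewrite [leRHS]EFinM; apply: lee_wpmul2l; [rewrite lee_fin divr_ge0// ltW|exact: int_N].
have hV : (c%:E * iter_int Pr n (fun ws => (Vr ws)%:E) <= (delta / 2)%:E)%E.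
  apply: (@le_trans _ _ (c * (kap * expR (n%:R * (b * S))))%:E).
    by rewrite [leRHS]EFinM; apply: lee_wpmul2l; [rewrite lee_fin ltW|exact: int_V].
  rewrite lee_fin.
  have -> : c * (kap * expR (n%:R * (b * S))) =
      expR (n%:R * (b * S - a * T)) * (2 * kap * delta)^-1.
    rewrite mulrBr expRB /c /s; field.
    by rewrite !gt_eqF// expR_gt0.
  rewrite ler_pdivrMr ?mulr_gt0//; apply: (le_trans hd).
  by rewrite le_eqVlt; apply/orP; left; apply/eqP; field.
have {}sum : (1%:E <= iter_int Pr n (fun ws => (posterior ws)%:E) + (delta / 2)%:E + (delta / 2)%:E)%E.
  by apply: (le_trans sum); apply: leeD => //; apply: leeD.
rewrite EFinB leeBlDr//; apply: (le_trans sum).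
rewrite -addeA -EFinD (_ : delta / 2 + delta / 2 = delta)//.
by field.
Qed.

End pac_bayes.

(** * The regression model *)

Lemma iter_int_eq (R : realType) d (Omega : measurableType d) (Pr : probability Omega R)
    n (G1 G2 : seq Omega -> \bar R) : (forall ws, size ws = n -> G1 ws = G2 ws) ->
  iter_int Pr n G1 = iter_int Pr n G2.
Proof.
elim: n G1 G2 => [|n ih] G1 G2 G12 /=; first exact: G12.
by apply: eq_integral => w _; apply: ih => ws sz; apply: G12; rewrite /= sz.
Qed.

Section regression.
Context (R : realType) (C Gam sig K B : R) (p L r : nat).
Context d (Omega : measurableType d) (Pr : probability Omega R).
Variables (X : Omega -> 'I_p -> R) (f : ('I_p -> R) -> R) (eps : Omega -> R).
Local Notation Theta := (Idx p L r -> R).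
Hypotheses (C1 : 1 <= C) (Gam0 : 0 < Gam) (K1 : 1 <= K) (B1 : 1 <= B).
Hypothesis mX : forall j : 'I_p, measurable_fun setT (fun w => X w j).
Hypothesis bf : borel_fun f.
Hypothesis meps : measurable_fun setT eps.
Hypothesis ieps : Pr.-integrable setT (EFin \o eps).
Hypothesis eps0 : forall A, sigmaX X A -> (\int[Pr]_(w in A) (eps w)%:E = 0)%E.
Hypothesis X2 : (\int[Pr]_w (\sum_(j < p) X w j ^+ 2)%:E <= (p%:R * K)%:E)%E.
Hypothesis fC : forall x, `|f x| <= C.
Hypothesis epsk : forall k : nat, (2 <= k)%N -> forall A, sigmaX X A ->
       (\int[Pr]_(w in A) (`|eps w| ^+ k)%:E
          <= ((k`!)%:R / 2 * sig ^+ 2 * Gam ^+ (k - 2))%:E * Pr A)%E.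

(** The feature space with its Borel structure as a measurable type, so that the events of sigma(X)
    are the preimages of measurable sets under one measurable map. *)
Let U : measurableType _ := g_sigma_algebraType (@cylinders R p).
Let XU : Omega -> U := X.
Let fU : U -> R := f.

Let C0 : 0 <= C. Proof. exact: le_trans ler01 C1. Qed.

Let mXU : measurable_fun setT XU.
Proof.
apply: (@measurability _ _ _ U setT XU (@cylinders R p)) => //.
move=> _ [_ [j [D [mD ->]]] <-].
exact: mX.
Qed.

Let mcoord (j : 'I_p) : measurable_fun setT (fun u : U => u j).
Proof.
move=> _ D mD; rewrite setTI; apply: sub_sigma_algebra.
by exists j, D.
Qed.

Let mfU : measurable_fun setT fU.
Proof. by move=> _ D mD; rewrite setTI; exact: bf. Qed.

Let mgU (th : Theta) : measurable_fun setT (fun u : U => fnet C th u).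
Proof.
apply: (@measurable_fnet R p L r C _ U (fun u => u) (fun=> th)) => //.
Qed.

Let gC (th : Theta) u : `|fnet C th u| <= C.
Proof. exact: clip_bound. Qed.

Let sX A : @measurable _ U A -> sigmaX X (XU @^-1` A).
Proof. by move=> mA; exists A. Qed.

Let eps0' A : @measurable _ U A -> (\int[Pr]_(w in XU @^-1` A) (eps w)%:E = 0)%E.
Proof. by move=> mA; exact: eps0 (sX mA). Qed.

Let epsk' k : (2 <= k)%N -> forall A, @measurable _ U A ->
  (\int[Pr]_(w in XU @^-1` A) (`|eps w| ^+ k)%:E
     <= (k`!%:R / 2 * sig ^+ 2 * Gam ^+ (k - 2))%:E * Pr (XU @^-1` A))%E.
Proof. by move=> k2 A mA; exact: epsk k2 _ (sX mA). Qed.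

Definition excessR (th : Theta) : R := fine (excess Pr X f (fnet C th)).

Lemma excessE th : excess Pr X f (fnet C th) = (excessR th)%:E.
Proof.
have /andP[a b] := excess_bound Pr mXU mfU (mgU th) fC (gC th).
by rewrite /excessR fineK// ge0_fin_numE//; exact: le_lt_trans b (ltry _).
Qed.

Definition excess_loss (w : Omega) (th : Theta) : R :=
  (f (X w) + eps w - fnet C th (X w)) ^+ 2 - eps w ^+ 2.

Let cm_fnet : cmeas (fun w (th : Theta) => fnet C th (X w)).
Proof.
move=> d' S w ph mw mph; apply: measurable_fnet => // k.
exact: (measurableT_comp (mX k)).
Qed.

Let cm_f : cmeas (fun w (th : Theta) => f (X w)).
Proof.
move=> d' S w ph mw mph.
by apply: (@measurableT_comp _ _ _ _ _ _ fU _ (XU \o w) mfU); exact: measurableT_comp.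
Qed.

Lemma cmeas_excess_loss : cmeas excess_loss.
Proof.
move=> d' S w ph mw mph; have mew : measurable_fun setT (fun s => eps (w s)).
  exact: measurableT_comp.
apply: measurable_funB; last exact: measurable_funX.
apply: measurable_funX; apply: measurable_funB; last exact: cm_fnet.
by apply: measurable_funD => //; exact: (cm_f mw mph).
Qed.

Lemma excess_loss_bound w th : `|excess_loss w th| <= 4 * C ^+ 2 + 4 * C * `|eps w|.
Proof.
rewrite /excess_loss; set u := f (X w); set g := fnet C th (X w); set e := eps w.
have -> : (u + e - g) ^+ 2 - e ^+ 2 = (u - g) ^+ 2 + 2 * (u - g) * e by ring.
have ug : `|u - g| <= 2 * C.
  by apply: (le_trans (ler_normB _ _)); have := fC (X w); have := gC th (X w); lra.
apply: (le_trans (ler_normD _ _)); apply: lerD.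
  rewrite normrX; have -> : 4 * C ^+ 2 = (2 * C) ^+ 2 by ring.
  by rewrite lerXn2r// nnegrE// mulr_ge0.
rewrite !normrM ger0_norm// ler_wpM2r//.
by rewrite -[leRHS]/(4 * C); lra.
Qed.

Lemma measurable_excess (T : R) d' (S : measurableType d') (ph : S -> Theta) :
  (forall i, measurable_fun setT (fun s => ph s i)) ->
  measurable (ph @^-1` [set th | excessR th <= T]).
Proof.
move=> mph.
(* The excess risk is seen as the integral over a sample of length one, so that [jmeas_int] yields
   its measurability in the parameter. *)
pose F (ws : seq Omega) (th : Theta) := ((fnet C th (X (head point ws)) - f (X (head point ws))) ^+ 2)%:E.
have F0 ws th : (0 <= F ws th)%E by rewrite lee_fin sqr_ge0.
have mF : jmeas 1 F.
  move=> d1 S1 ps ph1 mps mph1; apply/measurable_EFinP; apply: measurable_funX.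
  apply: measurable_funB; first exact: (cm_fnet (mps 0%N) mph1).
  exact: (cm_f (mps 0%N) mph1).
have mE : measurable_fun setT (fun s => excess Pr X f (fnet C (ph s))).
  apply: (jmeas_int Pr F0 mF (ps := fun _ => cst point)) => // _.
have := emeasurable_fun_infty_c measurableT mE T%:E.
rewrite setTI; congr measurable; apply/seteqP; split => s /=;
  by rewrite excessE lee_fin.
Qed.

Variable t : R.
Hypotheses (t0 : 0 < t) (tC : 20 * C ^+ 2 * t <= 1) (tsig : 40 * sig ^+ 2 * t <= 1).
Hypothesis tGam : 8 * C * Gam * t <= 1.

Lemma excess_loss_mgf_neg th :
  (\int[Pr]_w (expR (- t * excess_loss w th))%:E <= (expR (- (4 / 5 * t * excessR th)))%:E)%E.
Proof.
exact: (mgf_neg_excess_loss mXU meps ieps eps0' epsk' Gam0 mfU (mgU th) fC (gC th) t0 tC tsig tGam).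
Qed.

Lemma excess_loss_mgf_pos th :
  (\int[Pr]_w (expR (t * excess_loss w th))%:E <= (expR (3 / 2 * t * excessR th))%:E)%E.
Proof.
exact: (mgf_excess_loss mXU meps ieps eps0' epsk' Gam0 mfU (mgU th) fC (gC th) t0 tC tsig tGam).
Qed.

Lemma excessR_ge0 th : 0 <= excessR th.
Proof. by rewrite -lee_fin -excessE; apply: integral_ge0 => w _; rewrite lee_fin sqr_ge0. Qed.

(** The factor 2 comes from (a + b)^2 <= 2 a^2 + 2 b^2. The Lipschitz error at input x is at most a
    multiple of eta sqrt(1 + |x|^2), whose square is integrable by the second moment bound. The
    radius B + 1 leaves room for a perturbation of size at most 1 of a parameter in the cube. *)
Lemma excess_stable : exists2 M : R, 0 <= M & forall th th' eta,
  0 <= eta -> (forall i, `|th i| <= B + 1) -> (forall i, `|th' i| <= B + 1) ->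
  (forall i, `|th i - th' i| <= eta) ->
  excessR th <= 2 * excessR th' + M * eta ^+ 2.
Proof.
have B0 : 0 <= B + 1 by move: B1; lra.
have [M M0 lip] := @fnet_lip R p L r (B + 1) C B0.
exists (2 * M ^+ 2 * (1 + p%:R * K)).
  by rewrite !mulr_ge0 ?sqr_ge0// addr_ge0// mulr_ge0//; move: K1; lra.
move=> th th' eta e0 thB thB' tt.
pose N (x : 'I_p -> R) := \sum_(j < p) x j ^+ 2.
have N0 x : 0 <= N x by apply: sumr_ge0 => j _; exact: sqr_ge0.
have mN : measurable_fun setT (fun w => N (X w)).
  by apply: measurable_sum => j; apply: measurable_funX; exact: mX.
have mfX : measurable_fun setT (fun w => f (X w)) by exact: (measurableT_comp mfU mXU).
have mgX th1 : measurable_fun setT (fun w => fnet C th1 (X w)).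
  by apply: measurable_fnet.
have ms th1 : measurable_fun setT (fun w => (fnet C th1 (X w) - f (X w)) ^+ 2).
  by apply: measurable_funX; exact: measurable_funB.
pose c := 2 * (M * eta) ^+ 2.
have c0 : 0 <= c by rewrite mulr_ge0// sqr_ge0.
have pw w : (fnet C th (X w) - f (X w)) ^+ 2 <=
    2 * (fnet C th' (X w) - f (X w)) ^+ 2 + c * (1 + N (X w)).
  set Q := Num.sqrt (1 + N (X w)).
  have Q2 : Q ^+ 2 = 1 + N (X w) by rewrite sqr_sqrtr// addr_ge0.
  have Q1 : 1 <= Q by rewrite -(sqrtr1 R) ler_wsqrtr// lerDl.
  have xQ k : `|X w k| <= Q.
    rewrite -sqrtr_sqr ler_wsqrtr// ler_wpDl//.
    by rewrite /N (bigD1 k)//= lerDl; apply: sumr_ge0 => j _; exact: sqr_ge0.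
  have := lip th th' eta Q (X w) e0 Q1 thB thB' tt xQ.
  set g := fnet C th _; set g' := fnet C th' _; set u := f _ => h.
  have h2 : (g - g') ^+ 2 <= (M * eta * Q) ^+ 2.
    by rewrite -(real_normK (num_real (g - g'))) lerXn2r// nnegrE// !mulr_ge0//; lra.
  have -> : c * (1 + N (X w)) = 2 * (M * eta * Q) ^+ 2 by rewrite /c -Q2; ring.
  have : (g - u) ^+ 2 <= 2 * (g' - u) ^+ 2 + 2 * (g - g') ^+ 2.
    by have := sqr_ge0 ((g' - u) - (g - g')); nra.
  by lra.
rewrite -lee_fin -excessE.
apply: (@le_trans _ _ (\int[Pr]_w (2 * (fnet C th' (X w) - f (X w)) ^+ 2 + c * (1 + N (X w)))%:E)%E).
  apply: intR_le => //; last by move=> w; exact: sqr_ge0.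
  by apply: measurable_funD; apply: measurable_funM => //; exact: measurable_funD.
rewrite intRD//; last 4 first.
- exact: measurable_funM.
- by apply: measurable_funM => //; exact: measurable_funD.
- by move=> w; rewrite mulr_ge0// sqr_ge0.
- by move=> w; rewrite mulr_ge0// addr_ge0.
rewrite EFinD; apply: leeD.
  rewrite intRZ//; last by move=> w; exact: sqr_ge0.
  by rewrite -/(excess Pr X f (fnet C th')) excessE -EFinM.
rewrite intRZ//; last 2 first.
- exact: measurable_funD.
- by move=> w; rewrite addr_ge0.
rewrite intRD// intR_cst.
apply: (@le_trans _ _ (c%:E * (1%:E + (p%:R * K)%:E))%E).
  by apply: lee_wpmul2l; [rewrite lee_fin|apply: leeD2l].
rewrite -EFinD -EFinM lee_fin /c le_eqVlt; apply/orP; left; apply/eqP; ring.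
Qed.

End regression.

(** * Choice of constants and the oracle inequality *)

Lemma int_prior_box (R : realType) (p L r : nat) (B eta : R) (I : {set Idx p L r})
    (ths : Idx p L r -> R) : 1 <= B -> 0 < eta -> eta <= 1 -> I != finset.set0 ->
  S_I B I ths ->
  (((eta / (4 * B * #|Idx p L r|%:R)) ^+ #|I|)%:E <=
   int_prior B (fun th => (\1_(box eta I ths) th)%:E))%E.
Proof.
move=> B1 e0 e1 I0 SI; have B0 : 0 < B by exact: lt_le_trans B1.
have h : (((eta / (2 * B)) ^+ #|I|)%:E <= int_PiI B I (fun th => (\1_(box eta I ths) th)%:E))%E.
  rewrite cardE; apply: (box_mass B1 e0 e1 SI).
    by move=> j; rewrite mem_enum => jI; rewrite /box_lo /box_hi (negbTE jI) lexx.
  by move=> j; rewrite mem_enum.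
have i0 th : (0 <= (\1_(box eta I ths) th : R)%:E)%E by rewrite lee_fin.
apply: le_trans (int_prior_ge B1 I0 i0).
apply: (@le_trans _ _ ((2 ^- #|I| / #|Idx p L r|%:R ^+ #|I|)%:E * ((eta / (2 * B)) ^+ #|I|)%:E)%E).
  have P0 : (0 < #|Idx p L r|)%N by apply: leq_trans (max_card I); rewrite card_gt0.
  have -> : eta / (4 * B * #|Idx p L r|%:R) = 2^-1 / #|Idx p L r|%:R * (eta / (2 * B)).
    by field; rewrite !gt_eqF// ltr0n.
  by rewrite -EFinM lee_fin [leLHS]exprMn [X in X * _]exprMn !exprVn.
by apply: lee_wpmul2l => //; rewrite lee_fin divr_ge0// ?invr_ge0 exprn_ge0.
Qed.

(* The exponent comparison behind the choice [Xi1 = 5 / t], with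
   [l = ln (maxn p n)], [i = #|I|] and [x] the approximation error. *)
Lemma exponent_le (R : realType) (t n i l Lr x D e ln2 lnd lnk : R) :
  0 < t -> 0 < n -> 1 <= i -> 1 <= Lr -> 1 <= l -> 0 <= x -> 0 <= ln2 ->
  3 * t * D <= n -> 0 <= - lnd -> lnk <= 2 * l -> e = D * n^-1 ^+ 2 ->
  n * (3 / 2 * t * (2 * x + e) -
       4 / 5 * t * (4 * x + 5 * t^-1 / n * (i * Lr * l + (ln2 - lnd)))) <=
  - (i * lnk) + 2 * lnd.
Proof.
move=> t0 n0 i1 L1 l1 x0 l20 Dn d0 kl ->.
(* The coefficient of n t x is 3 - 16/5 = -1/5, and the 5 in Xi1 makes the penalty 4 = 4/5 * 5. Of 4
   i Lr l, at least 2 i l pays for the prior mass and the rest for the Lipschitz remainder, which is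
   at most 1/2; 4 (ln 2 - ln delta) covers the two powers of delta. *)
have -> : n * (3 / 2 * t * (2 * x + D * n^-1 ^+ 2) -
       4 / 5 * t * (4 * x + 5 * t^-1 / n * (i * Lr * l + (ln2 - lnd)))) =
   3 / 2 * t * D / n - n * t * x / 5 - 4 * (i * Lr * l + (ln2 - lnd)).
  by field; rewrite !gt_eqF.
have h1 : 3 / 2 * t * D / n <= 1 / 2 by rewrite ler_pdivrMr//; lra.
have h2 : 0 <= n * t * x by rewrite !mulr_ge0// ltW.
have il : i * l <= i * Lr * l.
  by rewrite -mulrA ler_wpM2l ?ler_peMl//; lra.
have h3 : i * lnk <= i * (2 * l) by rewrite ler_wpM2l//; lra.
have h4 : 1 <= i * l by rewrite -[leLHS]mulr1 ler_pM.
by lra.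
Qed.

Theorem theorem3p2 (R : realType) (C Gam sig : R) :
  1 <= C -> 0 < Gam -> 0 < sig ->
  exists Xi0 Xi1 : R, 0 < Xi0 /\ 0 < Xi1 /\
  forall (K B : R) (p L r : nat)
    (d : measure_display) (Omega : measurableType d) (Pr : probability Omega R)
    (X : Omega -> 'I_p -> R) (f : ('I_p -> R) -> R) (eps Y : Omega -> R)
    (thstar : {set Idx p L r} -> (Idx p L r -> R)),
    1 <= K -> 1 <= B -> (0 < p)%N -> (0 < L)%N -> (0 < r)%N ->
    (* model *)
    (forall j : 'I_p, measurable_fun setT (fun w => X w j)) ->
    borel_fun f ->
    measurable_fun setT eps ->
    (forall w, Y w = f (X w) + eps w) ->
    (* E[eps | X] = 0 a.s. *)
    Pr.-integrable setT (EFin \o eps) ->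
    (forall A, sigmaX X A -> (\int[Pr]_(w in A) (eps w)%:E = 0)%E) ->
    (* (1) *)
    (\int[Pr]_w (\sum_(j < p) X w j ^+ 2)%:E <= (p%:R * K)%:E)%E ->
    (forall x, `|f x| <= C) ->
    (* (2) E[|eps|^k | X] <= k!/2 sig^2 Gam^(k-2) a.s. for all k >= 2 *)
    (forall k : nat, (2 <= k)%N -> forall A, sigmaX X A ->
       (\int[Pr]_(w in A) (`|eps w| ^+ k)%:E
          <= ((k`!)%:R / 2 * sig ^+ 2 * Gam ^+ (k - 2))%:E * Pr A)%E) ->
    (* oracles theta*_I in argmin_{S_I} R(theta) *)
    (forall I : {set Idx p L r}, I != finset.set0 ->
       S_I B I (thstar I) /\
       forall th, S_I B I th ->
         (risk Pr X Y (fnet C (thstar I)) <= risk Pr X Y (fnet C th))%E) ->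
    exists N : nat, forall n : nat, (N <= n)%N ->
    forall delta : R, 0 < delta < 1 ->
      ((1 - delta)%:E <=
       prob_event Pr C B (n%:R / Xi0) X Y n
         [set th : Idx p L r -> R |
            (excess Pr X f (fnet C th) <=
             \big[Order.min/+oo%E]_(I : {set Idx p L r} | I != finset.set0)
               (4%:E * excess Pr X f (fnet C (thstar I))
                + (Xi1 / n%:R * (#|I|%:R * L%:R * ln (maxn p n)%:R
                                  + ln (2 / delta)))%:E))%E])%E.
Proof.
move=> C1 Gam0 sig0.
(* The sum dominates each of the three quantities whose product with t = 1 / Xi0 must be at most 1,
   and involves only C, sig and Gam. *)
pose Xi0 := 20 * C ^+ 2 + 40 * sig ^+ 2 + 8 * C * Gam.
have C0 : 0 < C by exact: lt_le_trans C1.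
have s1 : 0 < 20 * C ^+ 2 by rewrite mulr_gt0// exprn_gt0.
have s2 : 0 < 40 * sig ^+ 2 by rewrite mulr_gt0// exprn_gt0.
have s3 : 0 < 8 * C * Gam by rewrite !mulr_gt0.
have Xi00 : 0 < Xi0 by rewrite /Xi0; lra.
exists Xi0, (5 * Xi0); split=> //; split; first by rewrite mulr_gt0.
move=> K B p L r d Omega Pr X f eps Y thstar K1 B1 p0 L0 r0 mX bf meps YE ieps eps0 X2 fC epsk star.
pose t := Xi0^-1.
have t0 : 0 < t by rewrite invr_gt0.
have tC : 20 * C ^+ 2 * t <= 1 by rewrite ler_pdivrMr// mul1r /Xi0; lra.
have tsig : 40 * sig ^+ 2 * t <= 1 by rewrite ler_pdivrMr// mul1r /Xi0; lra.
have tGam : 8 * C * Gam * t <= 1 by rewrite ler_pdivrMr// mul1r /Xi0; lra.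
have [D D0 stable] := excess_stable (Pr := Pr) L r C1 K1 B1 mX bf X2 fC.
set P := #|Idx p L r|.
have iP : (0 < P)%N by apply/card_gt0P; exists (inr (inr tt)).
have B0 : 0 < B by exact: lt_le_trans B1.
have PR : 0 < P%:R :> R by rewrite ltr0n.
(* All that depends on the network, the prior and the design goes into the threshold for n: n >= 4BP
   gives ln(4BPn) <= 2 ln n, n >= 3tD absorbs the Lipschitz constant, and n >= e gives ln n >= 1. *)
pose Q := 1 + 4 * B * P%:R + 3 * t * D + expR 1.
have q1 : 0 <= 4 * B * P%:R by rewrite !mulr_ge0// ltW.
have q2 : 0 <= 3 * t * D by rewrite !mulr_ge0// ltW.
have q3 : 0 < expR 1 :> R by exact: expR_gt0.
have Q0 : 0 <= Q by rewrite /Q; lra.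
exists (Num.bound Q) => n Nn delta /andP[d0 d1].
have Qn : Q < n%:R by apply: (lt_le_trans (archi_boundP Q0)); rewrite ler_nat.
have n1 : 1 <= n%:R :> R by move: Qn; rewrite /Q; lra.
have n0 : 0 < n%:R :> R by exact: lt_le_trans n1.
have nBP : 4 * B * P%:R <= n%:R by move: Qn; rewrite /Q; lra.
have nD : 3 * t * D <= n%:R by move: Qn; rewrite /Q; lra.
have nexp : expR 1 <= n%:R :> R by move: Qn; rewrite /Q; lra.
set l := ln (maxn p n)%:R.
have nmax : n%:R <= (maxn p n)%:R :> R by rewrite ler_nat leq_maxr.
have lnl : ln n%:R <= l by rewrite /l ler_ln ?posrE// (lt_le_trans n0).
have ln1 : 1 <= ln n%:R :> R by rewrite -ler_expR lnK ?posrE.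
pose FI (I : {set Idx p L r}) : \bar R := (4%:E * excess Pr X f (fnet C (thstar I))
  + (5 * Xi0 / n%:R * (#|I|%:R * L%:R * l + ln (2 / delta)))%:E)%E.
(* The minimum is attained, at a support that depends neither on the data nor on the draw. The event
   is thus one sublevel set of the excess risk, and no union over supports is needed. The singleton
   of the output bias shows that the range is nonempty, so the default [+oo] is never the value. *)
have [I0 PI0 minE] : {I0 : {set Idx p L r} | I0 \in [pred I | I != finset.set0] &
   \big[Order.min/+oo%E]_(I : {set Idx p L r} | I != finset.set0) FI I = FI I0}.
  apply: (eq_bigmin (finset.set1 (inr (inr tt)))) => [|I _]; last exact: leey.
  by apply/set0Pn; exists (inr (inr tt)); rewrite inE.
rewrite inE in PI0.
rewrite -/FI minE.
have exE := @excessE R C p L r d Omega Pr X f C1 mX bf fC.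
set Ex := @excessR R C p L r d Omega Pr X f in exE.
pose T := 4 * Ex (thstar I0) + 5 * Xi0 / n%:R * (#|I0|%:R * L%:R * l + ln (2 / delta)).
rewrite (_ : mkset _ = [set th | Ex th <= T]); last first.
  by apply/funext => th /=; rewrite /FI !exE -EFinM -EFinD lee_fin.
set A := [set th | _].
have [SI _] := star I0 PI0.
pose eta : R := n%:R^-1.
have eta0 : 0 < eta by rewrite invr_gt0.
(* With radius 1/n the Lipschitz error, quadratic in eta, contributes order 1/n to the exponent,
   while the prior mass costs only ln n per active coordinate. *)
have eta1 : eta <= 1 by rewrite invf_le1.
pose U := box eta I0 (thstar I0).
pose J := @int_prior R p L r B.
have iJ : integral_functional Pr J by exact: int_prior_functional.
have J1 : J (fun=> 1%:E) = 1%:E by exact: int_prior1.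
pose z := @excess_loss R C p L r d Omega X f eps.
have mz : cmeas z by exact: cmeas_excess_loss.
have mA d' (S : measurableType d') (ph : S -> Idx p L r -> R) :
    (forall i, measurable_fun setT (fun s => ph s i)) -> measurable (ph @^-1` A).
  by move=> mph; exact: measurable_excess.
have mU d' (S : measurableType d') (ph : S -> Idx p L r -> R) :
    (forall i, measurable_fun setT (fun s => ph s i)) -> measurable (ph @^-1` U).
  exact: measurable_box.
have zb := excess_loss_bound X eps C1 fC : forall w (th : Idx p L r -> R), `|z w th| <= _.
pose kap := fine (J (fun th => (\1_U th)%:E)).
have kapE : J (fun th => (\1_U th)%:E) = kap%:E.
  apply: (functional_fin iJ J1 (h := \1_U) (k := 1)); last exact: jmeas_indic.
  by move=> th; rewrite indicE; case: (_ \in _); rewrite ?lexx ?ler01.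
have kap_ge : (eta / (4 * B * P%:R)) ^+ #|I0| <= kap.
  by rewrite -lee_fin -kapE; exact: int_prior_box.
have base0 : 0 < eta / (4 * B * P%:R) by rewrite divr_gt0// !mulr_gt0.
have kap0 : 0 < kap by apply: lt_le_trans kap_ge; rewrite exprn_gt0.
have starB i : `|thstar I0 i| <= B.
  have [h1 h2] := SI i; have [iI|iI] := boolP (i \in I0).
    by rewrite ler_norml; exact: h1.
  by rewrite h2// normr0 ltW.
pose S := 2 * Ex (thstar I0) + D * eta ^+ 2.
have US th : U th -> Ex th <= S.
  move=> Uth; have cl i := box_close eta0 SI i Uth.
  apply: stable => //; first exact: ltW.
  - move=> i; have := ler_normD (th i - thstar I0 i) (thstar I0 i).
    rewrite subrK => /le_trans; apply; rewrite addrC lerD//.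
    exact: le_trans (cl i) eta1.
  - by move=> i; apply: (le_trans (starB i)); rewrite lerDl.
have AT th : ~ A th -> T < Ex th by move=> /negP; rewrite -ltNge.
have a0 : 0 <= 4 / 5 * t by rewrite mulr_ge0// ltW.
have b0 : 0 <= 3 / 2 * t by rewrite mulr_ge0// ltW.
have mgfn := @excess_loss_mgf_neg R C Gam sig p L r d Omega Pr X f eps C1 Gam0 mX bf meps ieps eps0 fC epsk t t0 tC tsig tGam.
have mgfp := @excess_loss_mgf_pos R C Gam sig p L r d Omega Pr X f eps C1 Gam0 mX bf meps ieps eps0 fC epsk t t0 tC tsig tGam.
have key : expR (n%:R * (3 / 2 * t * S - 4 / 5 * t * T)) <= kap * delta ^+ 2.
  have -> : delta ^+ 2 = expR (2 * ln delta) by rewrite expRM_natl lnK.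
  apply: (@le_trans _ _ ((eta / (4 * B * P%:R)) ^+ #|I0| * expR (2 * ln delta))); last first.
    by rewrite ler_wpM2r// expR_ge0.
  pose lnk : R := ln (4 * B * P%:R * n%:R).
  have c0 : 0 < 4 * B * P%:R :> R by rewrite !mulr_gt0.
  have -> : eta / (4 * B * P%:R) = expR (- lnk).
    by rewrite expRN lnK ?posrE ?mulr_gt0// /eta [RHS]invfM mulrC.
  rewrite -expRM_natl -expRD ler_expR mulrN /S /T lnM ?lnV ?posrE ?invr_gt0//.
  rewrite /eta -[Xi0]invrK -/t.
  apply: exponent_le => //.
  - by rewrite ler1n card_gt0.
  - by rewrite ler1n.
  - exact: le_trans lnl.
  - exact: excessR_ge0.
  - by rewrite ln_ge0// ler1n.
  - exact: nD.
  - by rewrite oppr_ge0 ln_le0// ltW.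
  - rewrite /lnk lnM ?posrE//.
    have : ln (4 * B * P%:R) <= ln n%:R by rewrite ler_ln ?posrE.
    by move=> h; rewrite [leRHS]mulr_natl mulr2n lerD// (le_trans h).
have := pac_bayes iJ J1 mz t0 zb mA mU kap0 AT US a0 b0 mgfn mgfp d0 key.
rewrite /prob_event => /le_trans; apply.
rewrite le_eqVlt; apply/orP; left; apply/eqP; apply: iter_int_eq => ws sz; congr EFin.
(* The temperature n t cancels the 1/n of the empirical risk, and each squared residual is the
   excess loss plus eps^2. *)
pose c : R := expR (- t * \sum_(w <- ws) eps w ^+ 2).
have cE th : expR (- (n%:R / Xi0) * emp_risk C [seq (X w, Y w) | w <- ws] th) =
    c * \prod_(w <- ws) expR (- t * z w th).
  rewrite /emp_risk size_map sz big_map /= /c -expR_sum -expRD; congr expR.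
  rewrite -mulr_sumr -mulrDr -big_split /= -/t mulrA; congr (_ * _).
    by rewrite /t; field; rewrite !gt_eqF.
  by apply: eq_bigr => w _; rewrite YE /z /excess_loss; ring.
rewrite /gibbs_post.
under [in RHS]eq_fun do rewrite cE.
under [in X in _ / fine X]eq_fun do rewrite cE.
by rewrite (posterior_scale iJ J1 mz t0 zb mA _ (expR_gt0 _)).
Qed.
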